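(* Let $\{S_i\}_{i=1}^\ell$ be an IFS of contracting similarities on $\mathbb{R}^d$, let $\rho_i\in(0,1)$ be the contraction ratio of $S_i$, let $(p_1,\ldots,p_\ell)$ be a probability vector with all $p_i>0$, and let $\mu$ be the associated self-similar measure. Then: (i) For any finite Borel partition $\mathscr{D}$ of $\mathbb{R}^d$ with respect to $\mu$, \[ \dim(\mu)\geq \frac{\left(\sum_{i=1}^\ell -p_i\log p_i\right) -\sum_{D\in \mathscr{D}} f\left(p_1\mu(S_1^{-1}D),\ldots, p_\ell\mu(S_\ell^{-1}D)\right) }{\sum_{i=1}^\ell -p_i\log \rho_i}; \] consequently, if $y_i(D)\ge 0$ are numbers with $p_i\mu(S_i^{-1}D)\leq y_i(D)$ for all $1\leq i\leq \ell$ and $D\in \mathscr{D}$, then \[ \dim(\mu)\geq \frac{\left(\sum_{i=1}^\ell -p_i\log p_i\right) -\sum_{D\in \mathscr{D}} f\left(y_1(D),\ldots, y_\ell(D)\right) }{\sum_{i=1}^\ell -p_i\log \rho_i}. \] (ii) If $(\mathscr{D}_n)$ is a sequence of finite Borel partitions of $\mathbb{R}^d$ with respect to $\mu$ such that $\max_{D\in \mathscr{D}_n}\operatorname{diam}(D)\to 0$ as $n\to\infty$, then the limit below exists and \[ \dim(\mu)=\frac{\left(\sum_{i=1}^\ell -p_i\log p_i\right) -\lim_{n\to \infty} \sum_{D\in \mathscr{D}_n} f\left(p_1\mu(S_1^{-1}D),\ldots, p_\ell\mu(S_\ell^{-1}D)\right) }{\sum_{i=1}^\ell -p_i\log \rho_i}.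 \]
   Context: The self-similar measure associated with the IFS and the probability vector is the unique Borel probability measure $\mu$ on $\mathbb{R}^d$ with $\mu=\sum_{i=1}^\ell p_i\,\mu\circ S_i^{-1}$. Such $\mu$ is exact dimensional: there is a constant $\dim(\mu)$ with $\lim_{r\to0}\log\mu(B_r(x))/\log r=\dim(\mu)$ for $\mu$-a.e. $x$, where $B_r(x)$ is the closed ball of radius $r$ centred at $x$. Let $\varphi(x)=-x\log x$ for $x>0$ and $\varphi(0)=0$. Define $f\colon[0,\infty)^\ell\to\mathbb{R}$ by $f(x_1,\ldots,x_\ell)=(x_1+\cdots+x_\ell)\sum_{i=1}^\ell\varphi\!\left(\frac{x_i}{x_1+\cdots+x_\ell}\right)$ (with $f(0,\ldots,0)=0$). For a Borel probability measure $\eta$ on $\mathbb{R}^d$, a finite collection $\mathscr{D}$ of Borel subsets of $\mathbb{R}^d$ is a finite Borel partition of $\mathbb{R}^d$ with respect to $\eta$ if $\eta(\bigcup_{D\in\mathscr{D}}D)=1$ and $\eta(D\cap D')=0$ for distinct $D,D'\in\mathscr{D}$. *)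

(* Defs.v *)
From HB Require Import structures.
From mathcomp Require Import all_boot all_order all_algebra.
From mathcomp Require Import all_classical all_reals all_analysis.
Set Implicit Arguments. Unset Strict Implicit. Unset Printing Implicit Defensive.
Import Order.TTheory GRing.Theory Num.Theory.
Import numFieldNormedType.Exports.
Local Open Scope classical_set_scope.
Local Open Scope ring_scope.

(* R^d, with points represented as row vectors, equipped with the Borel
   sigma-algebra: the sigma-algebra generated by the open sets (the product
   topology on 'rV[R]_d is the Euclidean topology). *)
Definition Rd (R : realType) (d : nat) :=
  g_sigma_algebraType (@open 'rV[R]_d).

Definition edist (R : realType) (d : nat) (x y : 'rV[R]_d) : R :=
  Num.sqrt (\sum_(k < d) (x ord0 k - y ord0 k) ^+ 2).

Definition eball (R : realType) (d : nat) (x : Rd R d) (r : R) : set (Rd R d) :=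
  [set y | edist x y <= r].

(* diameter (extended real; diam of the empty set is 0) *)
Definition ediam (R : realType) (d : nat) (D : set (Rd R d)) : \bar R :=
  ereal_sup ([set (edist x y)%:E | x in D & y in D] `|` [set 0%E]).

Definition similarity_ratio (R : realType) (d : nat)
  (S : Rd R d -> Rd R d) (rho : R) : Prop :=
  0 < rho < 1 /\ forall x y, edist (S x) (S y) = rho * edist x y.

Definition self_similar (R : realType) (d l : nat)
  (S : 'I_l -> Rd R d -> Rd R d) (p : 'I_l -> R)
  (mu : probability (Rd R d) R) : Prop :=
  forall A : set (Rd R d), measurable A ->
    mu A = (\sum_(i < l) (p i)%:E * mu (S i @^-1` A))%E.

Definition exact_dim (R : realType) (d : nat)
  (mu : probability (Rd R d) R) (s : R) : Prop :=
  {ae mu, forall x : Rd R d,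
     (fun r : R => ln (fine (mu (eball x r))) / ln r) @ 0^'+ --> s}.

Definition phi (R : realType) (x : R) : R := if x == 0 then 0 else - (x * ln x).

Definition fent (R : realType) (l : nat) (x : 'I_l -> R) : R :=
  let t := \sum_(i < l) x i in
  if t == 0 then 0 else t * \sum_(i < l) phi (x i / t).

Definition borel_partition (R : realType) (d m : nat)
  (mu : probability (Rd R d) R) (D : 'I_m -> set (Rd R d)) : Prop :=
  (forall j, measurable (D j)) /\
  mu (\bigcup_(j in [set: 'I_m]) D j) = 1%E /\
  (forall j k, j != k -> mu (D j `&` D k) = 0%E).

Definition part_sum (R : realType) (d l m : nat)
  (S : 'I_l -> Rd R d -> Rd R d) (p : 'I_l -> R)
  (mu : probability (Rd R d) R) (D : 'I_m -> set (Rd R d)) : R :=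
  \sum_(j < m) fent (fun i => p i * fine (mu (S i @^-1` D j))).

Definition entropy (R : realType) (l : nat) (p : 'I_l -> R) : R :=
  \sum_(i < l) - (p i * ln (p i)).

Definition lyap (R : realType) (l : nat) (p rho : 'I_l -> R) : R :=
  \sum_(i < l) - (p i * ln (rho i)).

Definition max_diam (R : realType) (d m : nat) (D : 'I_m -> set (Rd R d)) : \bar R :=
  \big[Order.max/0%E]_(j < m) ediam (D j).

(* Main.v *)
From HB Require Import structures.
From mathcomp Require Import all_boot all_order all_algebra.
From mathcomp Require Import all_classical all_reals all_analysis.
From mathcomp Require Import ring lra.
(* Imported last because the analysis library has its own [edist]. *)
Require Import Defs.
Set Implicit Arguments. Unset Strict Implicit. Unset Printing Implicit Defensive.
Import Order.TTheory GRing.Theory Num.Theory.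
Import numFieldNormedType.Exports.
Local Open Scope classical_set_scope.
Local Open Scope ring_scope.

(* Write H(D) for the entropy of mu on a finite partition D and P(D) for the sum
   of f over D, i.e. the entropy of the first symbol given D. The chain rule gives
   H(D) = H(p) - P(D) + sum_i p_i H(S_i^-1 D). For diam D <= r small, approximation
   of Borel sets by unions of cells gives P(D) <= P(D0) + e for any fixed D0, so H
   satisfies a renewal inequality in the scale r, whence
   H(D) >= ((H(p) - P(D0) - e) / lambda) ln(1/r) - C, where lambda = lyap p rho.
   On the other hand, exact dimensionality yields partitions of diameter O(r) with
   H(D) <= (s + e) ln(1/r) + O(1) up to a small multiple of ln(1/r). This proves (i).

   For the reverse bound, V_r(D) = - sum_D mu(D) ln mu(D^r), with D^r the open
   r-neighbourhood of D, plays the role of - int ln mu(B(x,r)) dmu. Gibbs'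
   inequality gives V_r(D) <= H(p) - P(D) + sum_i p_i V_(r/rho_i)(S_i^-1 D) for every
   partition D, so with h = inf P the renewal argument yields
   V_r(D) <= ((H(p) - h) / lambda) ln(1/r) + C, while V_r(D) >= (s - e) ln(1/r)
   (1 - e) - O(1) for fine D. Finally P(D_n) -> inf P by the approximation above. *)

(** * Entropy inequalities *)

Section entropy_function.
Context {R : realType}.
Implicit Types (x y : R).

Lemma phi0 : phi (0 : R) = 0.
Proof. by rewrite /phi eqxx. Qed.

Lemma phiE x : phi x = - (x * ln x).
Proof. by rewrite /phi; case: eqP => // ->; rewrite mul0r oppr0. Qed.

Lemma phi_ge0 x : 0 <= x <= 1 -> 0 <= phi x.
Proof.
move=> /andP[x0 x1]; rewrite phiE oppr_ge0.
by rewrite mulr_ge0_le0 // ln_le0.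
Qed.

Lemma ln_le_subr1 x : 0 < x -> ln x <= x - 1.
Proof.
by move=> x0; have := @le_ln1Dx R (x - 1); rewrite subrKC; apply; lra.
Qed.

Lemma mul_ln_div_le x y : 0 <= x -> 0 <= y -> (0 < x -> 0 < y) ->
  x * (ln y - ln x) <= y - x.
Proof.
move=> x0 y0 xy; move: x0; rewrite le_eqVlt => /predU1P[<-|x0].
  by rewrite mul0r subr0.
have {}y0 := xy x0.
have := @ln_le_subr1 (y / x) (divr_gt0 y0 x0).
rewrite ln_div ?posrE // => h.
have -> : y - x = x * (y / x - 1).
  by rewrite mulrBr mulr1 mulrCA divff ?mulr1 ?gt_eqF.
by rewrite ler_pM2l.
Qed.

Lemma phi_le1 x : 0 <= x -> phi x <= 1.
Proof.
move=> x0; rewrite phiE.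
have := @mul_ln_div_le x 1 x0 ler01 (fun=> ltr01); rewrite ln1; lra.
Qed.

(** A modulus of continuity of [phi] at 0, obtained from [- (x * ln x) <= 1 - x] times [2 * x].
    Writing small masses as squares avoids square roots. *)
Lemma phi_sqr_le x : 0 <= x -> phi (x ^+ 2) <= 2 * x.
Proof.
move=> x0; rewrite phiE; move: x0; rewrite le_eqVlt => /predU1P[<-|x0].
  by rewrite expr0n /= mul0r oppr0 mulr0.
have := @mul_ln_div_le x 1 (ltW x0) ler01 (fun=> ltr01); rewrite ln1 lnXn // => h.
have h2 : x * (x * (0 - ln x)) <= x * (1 - x) by rewrite ler_pM2l.
have x2 := sqr_ge0 x; rewrite expr2 in x2 *.
lra.
Qed.

Lemma phiM x y : 0 <= x -> 0 <= y -> phi (x * y) = x * phi y + y * phi x.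
Proof.
move=> x0 y0; rewrite !phiE.
move: x0; rewrite le_eqVlt => /predU1P[<-|x0]; first by rewrite !mul0r; ring.
move: y0; rewrite le_eqVlt => /predU1P[<-|y0]; first by rewrite !(mul0r,mulr0); ring.
rewrite lnM ?posrE //; ring.
Qed.

Lemma phiD_le x y : 0 <= x -> 0 <= y -> phi (x + y) <= phi x + phi y.
Proof.
move=> x0 y0; rewrite !phiE.
move: x0; rewrite le_eqVlt => /predU1P[<-|x0]; first by rewrite !(mul0r,add0r) oppr0 add0r.
move: y0; rewrite le_eqVlt => /predU1P[<-|y0]; first by rewrite !(mul0r,addr0) oppr0 addr0.
have xy : 0 < x + y by exact: addr_gt0.
have h1 : ln x <= ln (x + y) by rewrite ler_ln ?posrE //; lra.
have h2 : ln y <= ln (x + y) by rewrite ler_ln ?posrE //; lra.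
have h3 : x * ln x <= x * ln (x + y) by rewrite ler_pM2l.
have h4 : y * ln y <= y * ln (x + y) by rewrite ler_pM2l.
lra.
Qed.

(** The difference is [x * (ln (x + y) - ln x) + y * ln (x + y)]. Each term is at most [y]: the
    first by [mul_ln_div_le], the second because [ln (x + y) <= x + y - 1 <= 1]. *)
Lemma phi_increment x y : 0 <= x -> 0 <= y -> x + y <= 2 ->
  phi x - phi (x + y) <= 2 * y.
Proof.
move=> x0 y0 xy2; rewrite !phiE.
have := @mul_ln_div_le x (x + y) x0; rewrite addr_ge0 // => /(_ isT).
case/boolP : (x == 0) => [/eqP-> _|xn0].
  rewrite mul0r oppr0 add0r add0r opprK.
  have [y1|y1] := leP y 1.
    have := ln_le0 y1; nra.
  have := @ln_le_subr1 y; nra.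
have x0' : 0 < x by rewrite lt_neqAle eq_sym xn0.
have h1 := @ln_le_subr1 (x + y).
have h2 : 0 < x + y by lra.
have := h1 h2 => {}h1.
move=> h; have := h (fun=> h2) => {}h.
have h3 : y * ln (x + y) <= y * 1 by apply: ler_wpM2l => //; lra.
lra.
Qed.

Variable l : nat.
Implicit Types (u v b : 'I_l -> R).

(** The normalisation disappears because [t * phi (x / t) = phi x + x * ln t]. For joint masses this
    exhibits [fent] as joint entropy minus marginal entropy. *)
Lemma fentE v : (forall i, 0 <= v i) ->
  fent v = \sum_(i < l) phi (v i) - phi (\sum_(i < l) v i).
Proof.
move=> v0; rewrite /fent; case: eqP => [t0|/eqP t0].
  rewrite t0 phi0 subr0 big1 // => i _.
  have /eqP := t0; rewrite psumr_eq0 // => /allP /(_ i).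
  by rewrite mem_index_enum => /(_ isT) /eqP ->; exact: phi0.
set t := \sum_(i < l) v i in t0 *.
have tp : 0 < t by rewrite lt_neqAle eq_sym t0 sumr_ge0.
rewrite big_distrr /=.
under eq_bigr => i _.
  have -> : t * phi (v i / t) = phi (v i) + v i * ln t.
    rewrite !phiE; case/boolP : (v i == 0) => [/eqP->|vn0].
      by rewrite !mul0r; ring.
    have vp : 0 < v i by rewrite lt_neqAle eq_sym vn0 v0.
    rewrite ln_div ?posrE //.
    have -> : t * - (v i / t * (ln (v i) - ln t)) =
              - ((v i * (t / t)) * (ln (v i) - ln t)) by ring.
    rewrite divff //; ring.
  over.
by rewrite big_split /= -big_distrl /= -/t phiE opprK.
Qed.

(* Gibbs' inequality. *)
Lemma fent_le_cross v b : (forall i, 0 <= v i) -> (forall i, 0 <= b i) ->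
  (forall i, 0 < v i -> 0 < b i) ->
  fent v <= \sum_(i < l) v i * (ln (\sum_(k < l) b k) - ln (b i)).
Proof.
move=> v0 b0 vb; rewrite fentE // phiE opprK.
set t := \sum_(i < l) v i; set B := \sum_(k < l) b k.
have [t0|tn0] := eqVneq t 0.
  have vi0 i : v i = 0.
    have /eqP := t0; rewrite psumr_eq0 // => /allP /(_ i).
    by rewrite mem_index_enum => /(_ isT) /eqP.
  rewrite t0 mul0r addr0 !big1 // => i _; rewrite vi0 ?phi0 ?mul0r //.
have tp : 0 < t by rewrite lt_neqAle eq_sym tn0 sumr_ge0.
have Bp : 0 < B.
  rewrite lt_neqAle sumr_ge0 // andbT eq_sym psumr_eq0 //.
  apply/negP => /allP bz; move/eqP : tn0; apply; apply: big1 => i _.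
  apply/eqP; rewrite eq_le v0 andbT leNgt; apply/negP => /vb.
  by have := bz i; rewrite mem_index_enum => /(_ isT) /eqP ->; rewrite ltxx.
rewrite -subr_le0 /t big_distrl /= -big_split -sumrB /= -/t.
(* [mul_ln_div_le] is applied termwise against [b] rescaled to total [t], so that the resulting
   bounds sum to 0. *)
apply: (@le_trans _ _ (\sum_(i < l) (b i * (t / B) - v i))).
  apply: ler_sum => i _.
  have := @mul_ln_div_le (v i) (b i * (t / B)) (v0 i).
  rewrite (mulr_ge0 (b0 i) (divr_ge0 (ltW tp) (ltW Bp))) => /(_ isT).
  have H : 0 < v i -> 0 < b i * (t / B).
    by move=> /vb b0'; rewrite mulr_gt0 // divr_gt0.
  move=> /(_ H) h; apply: (le_trans _ h); rewrite phiE.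
  have [->|vn0] := eqVneq (v i) 0; first by rewrite !mul0r; lra.
  have vp : 0 < v i by rewrite lt_neqAle eq_sym vn0 v0.
  have bp := vb i vp.
  rewrite lnM ?posrE ?divr_gt0 // ln_div ?posrE //; lra.
rewrite sumrB -big_distrl /= -/t -/B mulrCA divff ?gt_eqF // mulr1 subrr //.
Qed.

Lemma fent_cross v : (forall i, 0 <= v i) ->
  fent v = \sum_(i < l) v i * (ln (\sum_(k < l) v k) - ln (v i)).
Proof.
move=> v0; rewrite fentE // phiE opprK big_distrl /= -big_split /=.
by apply: eq_bigr => i _; rewrite phiE; ring.
Qed.

Lemma fent_ge0 v : (forall i, 0 <= v i) -> 0 <= fent v.
Proof.
move=> v0; rewrite fent_cross // sumr_ge0 // => i _.
have [->|vn0] := eqVneq (v i) 0; first by rewrite mul0r.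
have vp : 0 < v i by rewrite lt_neqAle eq_sym vn0 v0.
rewrite mulr_ge0 // subr_ge0 ler_ln ?posrE //.
  by rewrite (bigD1 i) //= lerDl sumr_ge0.
by rewrite (bigD1 i) //= ltr_pwDl // sumr_ge0.
Qed.

(** Gibbs' inequality bounds each [fent (w k)] by its cross entropy against the summed vector; by
    [fent_cross] these cross entropies add up to the right-hand side. In entropy terms, coarser
    conditioning leaves more uncertainty. *)
Lemma fent_superadditive (I : finType) (Q : pred I) (w : I -> 'I_l -> R) :
  (forall k i, 0 <= w k i) ->
  \sum_(k | Q k) fent (w k) <= fent (fun i => \sum_(k | Q k) w k i).
Proof.
move=> w0; rewrite [leRHS]fent_cross; last by move=> i; exact: sumr_ge0.
under [leRHS]eq_bigr do rewrite big_distrl /=.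
rewrite exchange_big /=; apply: ler_sum => k Qk.
apply: fent_le_cross => // i; first exact: sumr_ge0.
by move=> wp; rewrite (bigD1 k) //= ltr_pwDl // sumr_ge0.
Qed.

Lemma fentD_ge u v : (forall i, 0 <= u i) -> (forall i, 0 <= v i) ->
  fent u + fent v <= fent (fun i => u i + v i).
Proof.
move=> u0 v0.
have := @fent_superadditive bool predT (fun k => if k then u else v).
rewrite big_bool /= => h; apply: le_trans (h _) _; first by case.
by rewrite le_eqVlt; apply/orP; left; apply/eqP; congr fent; apply/funext => i; rewrite big_bool.
Qed.

(** Superadditivity applied to [u] and [v - u], with nonnegativity of the second term. This yields
    the second claim of (i). *)
Lemma fent_le u v : (forall i, 0 <= u i) -> (forall i, u i <= v i) ->
  fent u <= fent v.
Proof.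
move=> u0 uv; have vu i : 0 <= v i - u i by rewrite subr_ge0.
have := @fentD_ge u (fun i => v i - u i) u0 vu.
have -> : (fun i => u i + (v i - u i)) = v by apply/funext => i; rewrite subrKC.
by apply: le_trans; rewrite lerDl fent_ge0.
Qed.

(** In the form [fentE], each [phi (v i)] grows by at most [phi (t ^+ 2) <= 2 * t], by
    subadditivity, and [phi] of the total drops by at most twice the total shift. *)
Lemma fent_shift_le v (t : R) : (forall i, 0 <= v i) -> 0 <= t ->
  \sum_(i < l) v i + l%:R * t ^+ 2 <= 2 ->
  fent (fun i => v i + t ^+ 2) <= fent v + l%:R * (2 * t + 2 * t ^+ 2).
Proof.
move=> v0 t0 h; have t20 : 0 <= t ^+ 2 by exact: sqr_ge0.
rewrite !fentE //; last by move=> i; exact: addr_ge0.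
have -> : \sum_(i < l) (v i + t ^+ 2) = \sum_(i < l) v i + l%:R * t ^+ 2.
  by rewrite big_split /= sumr_const card_ord mulr_natl.
have s0 : 0 <= \sum_(i < l) v i by exact: sumr_ge0.
have h1 := @phi_increment _ _ s0 (mulr_ge0 (ler0n R l) t20) h.
have h2 : \sum_(i < l) phi (v i + t ^+ 2) <= \sum_(i < l) phi (v i) + l%:R * (2 * t).
  apply: (@le_trans _ _ (\sum_(i < l) (phi (v i) + 2 * t))).
    apply: ler_sum => i _; apply: (le_trans (phiD_le (v0 i) t20)).
    by rewrite lerD2l phi_sqr_le.
  by rewrite big_split /= sumr_const card_ord -[_ *+ l]mulr_natl.
lra.
Qed.

End entropy_function.

(** Gibbs' inequality against the constant vector 1; the last term accounts for masses that do not
    add up to 1. *)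
Lemma sum_phi_le_card {R : realType} (I : finType) (Z : {set I}) (x : I -> R) :
  (forall i, 0 <= x i) ->
  \sum_(i in Z) phi (x i) <=
  (\sum_(i in Z) x i) * ln #|Z|%:R + phi (\sum_(i in Z) x i).
Proof.
move=> x0.
have E F : \sum_(i in Z) F i = \sum_(k < #|Z|) F (enum_val k) :> R.
  by rewrite -big_enum_val.
rewrite !E.
have := @fent_le_cross _ _ (fun k : 'I_#|Z| => x (enum_val k)) (fun=> 1).
rewrite fentE //; move=> /(_ (fun k => x0 _) (fun=> ler01) (fun _ _ => ltr01)).
rewrite sumr_const card_ord -[1 *+ _]/(#|Z|%:R) ln1 subr0 -big_distrl /=; lra.
Qed.

(** * Renewal inequalities and Euclidean distance *)

Lemma expr_eventually_lt {R : realType} (z K e : R) : 0 <= z < 1 -> 0 <= K -> 0 < e ->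
  exists N : nat, forall n, (N <= n)%N -> K * z ^+ n < e.
Proof.
move=> /andP[z0 z1] K0 e0.
have K1 : 0 < K + 1 by lra.
have : GRing.exp z @ \oo --> 0 by apply: cvg_expr; rewrite ger0_norm.
move=> /cvgrPdist_lt /(_ (e / (K + 1)) (divr_gt0 e0 K1)) [N _ hN].
exists N => n Nn; have := hN n Nn; rewrite /= sub0r normrN ger0_norm ?exprn_ge0 //.
rewrite ltr_pdivlMr //; have := exprn_ge0 n z0; lra.
Qed.

Section renewal.
Context {R : realType} {l : nat} (p rho : 'I_l -> R).
Hypothesis p0 : forall i, 0 < p i.
Hypothesis p1 : \sum_(i < l) p i = 1.
Hypothesis rho01 : forall i, 0 < rho i < 1.

Lemma lyap_gt0 : 0 < lyap p rho.
Proof.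
have h i : 0 < - (p i * ln (rho i)).
  by rewrite oppr_gt0 pmulr_rlt0 // ln_lt0.
rewrite /lyap lt_neqAle sumr_ge0 ?andbT; last by move=> i _; exact: ltW.
rewrite eq_sym psumr_eq0; last by move=> i _; exact: ltW.
apply/negP => /allP hall.
move: p1; rewrite big1; first by move/eqP; rewrite eq_sym oner_eq0.
by move=> i _; have := hall i; rewrite mem_index_enum (gt_eqF (h i)) => /(_ isT).
Qed.

Variables (rmin rmax : R).
Hypothesis rminP : forall i, rmin <= rho i.
Hypothesis rmaxP : forall i, rho i <= rmax.
Hypothesis rmin0 : 0 < rmin.
Hypothesis rmax01 : 0 < rmax < 1.

(** With [b = c / lyap p rho], the function [b * - ln r] solves the recursion with equality, since
    the [p]-average of [- ln (r / rho i)] is [- ln r - lyap p rho]. A bound of this form plus a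
    constant therefore passes from the scales [r / rho i] to [r]. The abstract [T] and [Q] let the
    lemma serve both [thick_entropy] and minus the partition entropy. *)
Lemma renewal_bound (T : Type) (pull : 'I_l -> T -> T) (Q : R -> T -> Prop)
    (F : R -> T -> R) (c C r0 : R) :
  0 < r0 <= 1 ->
  (forall r E i, Q r E -> Q (r / rho i) (pull i E)) ->
  (forall r E, 0 < r <= r0 -> Q r E ->
     F r E <= c + \sum_(i < l) p i * F (r / rho i) (pull i E)) ->
  (forall r E, rmin * r0 <= r <= r0 -> Q r E -> F r E <= C) ->
  forall r E, 0 < r <= r0 -> Q r E ->
    F r E <= c / lyap p rho * - ln r + (C + `|c / lyap p rho| * - ln (rmin * r0)).
Proof.
move=> /andP[r00 r01] Qpull Frec Fbase r E /andP[rp rr0] QE.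
set b := c / lyap p rho; set C' := C + _.
have m0 : 0 < rmin * r0 by exact: mulr_gt0.
(* One use of the recursion extends the range of scales downwards by a factor [rmax], since
   [r / rho i >= r / rmax]. *)
suff H n : forall r E, rmin * r0 * rmax ^+ n <= r <= r0 -> Q r E -> F r E <= b * - ln r + C'.
  have rmax01' : 0 <= rmax < 1 by case/andP: rmax01 => /ltW -> ->.
  have [N hN] := expr_eventually_lt rmax01' (ltW m0) rp.
  by apply: (H N) => //; rewrite rr0 andbT ltW // hN.
clear r E rp rr0 QE.
(* The second term of the constant absorbs [b * - ln r] on this window, whatever the sign of [b]. *)
have base r E : rmin * r0 <= r <= r0 -> Q r E -> F r E <= b * - ln r + C'.
  move=> rI QE; apply: (le_trans (Fbase _ _ rI QE)); case/andP: rI => r1 r2.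
  have rp : 0 < r by lra.
  have l1 : 0 <= - ln r by rewrite oppr_ge0 ln_le0 //; lra.
  have l2 : - ln r <= - ln (rmin * r0) by rewrite lerN2 ler_ln ?posrE.
  have h1 : `|b * - ln r| <= `|b| * - ln (rmin * r0).
    by rewrite normrM (ger0_norm l1) ler_wpM2l.
  have := ler_norm (- (b * - ln r)); rewrite normrN /C' -/b; lra.
elim: n => [|n IH] r E /andP[rn rr0] QE.
  by apply: base => //; rewrite rr0 andbT -[_ * r0]mulr1.
have [rb|rb] := leP (rmin * r0) r; first by apply: base => //; rewrite rb.
have rp : 0 < r.
  by apply: lt_le_trans rn; rewrite mulr_gt0 // exprn_gt0 //; case/andP: rmax01.
have rhop i : 0 < rho i by case/andP: (rho01 i).
apply: (@le_trans _ _ (c + \sum_(i < l) p i * (b * - ln (r / rho i) + C'))).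
  apply: (le_trans (Frec _ _ _ QE)); first by rewrite rp rr0.
  rewrite lerD2l; apply: ler_sum => i _; rewrite ler_pM2l //.
  apply: IH; last exact: Qpull.
  apply/andP; split.
    rewrite ler_pdivlMr //; apply: le_trans rn; rewrite exprSr mulrA.
    apply: ler_wpM2l => //; rewrite mulr_ge0 ?exprn_ge0 // ?ltW //.
    by case/andP: rmax01.
  rewrite ler_pdivrMr // mulrC; apply: (le_trans (ltW rb)).
  by rewrite ler_pM2r.
have -> : \sum_(i < l) p i * (b * - ln (r / rho i) + C') =
          b * - ln r + C' - b * lyap p rho.
  transitivity (\sum_(i < l) (p i * (b * - ln r + C') - b * - (p i * ln (rho i)))).
    by apply: eq_bigr => i _; rewrite ln_div ?posrE //; ring.
  by rewrite sumrB -big_distrl /= p1 mul1r -big_distrr.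
have -> : b * lyap p rho = c by rewrite /b mulfVK // gt_eqF // lyap_gt0.
lra.
Qed.

End renewal.

(** * Euclidean distance and the product topology *)

Section euclidean_distance.
Context {R : realType} {d : nat}.
Implicit Types (x y z : 'rV[R]_d).

Lemma edist_ge0 x y : 0 <= edist x y.
Proof. exact: sqrtr_ge0. Qed.

Lemma edistC x y : edist x y = edist y x.
Proof. by congr Num.sqrt; apply: eq_bigr => k _; rewrite -sqrrN opprB. Qed.

Lemma edistxx x : edist x x = 0.
Proof.
by rewrite /edist big1 ?sqrtr0 // => k _; rewrite subrr expr0n.
Qed.

Lemma cauchy_schwarz_sum (a b : 'I_d -> R) :
  \sum_(k < d) a k * b k <=
  Num.sqrt (\sum_(k < d) a k ^+ 2) * Num.sqrt (\sum_(k < d) b k ^+ 2).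
Proof.
have A0 : 0 <= \sum_(k < d) a k ^+ 2 by apply: sumr_ge0 => k _; exact: sqr_ge0.
have B0 : 0 <= \sum_(k < d) b k ^+ 2 by apply: sumr_ge0 => k _; exact: sqr_ge0.
set A := Num.sqrt (\sum_(k < d) a k ^+ 2); set B := Num.sqrt (\sum_(k < d) b k ^+ 2).
have EA : \sum_(k < d) a k ^+ 2 = A ^+ 2 by rewrite sqr_sqrtr.
have EB : \sum_(k < d) b k ^+ 2 = B ^+ 2 by rewrite sqr_sqrtr.
have zero (u : 'I_d -> R) : \sum_(k < d) u k ^+ 2 = 0 -> forall k, u k = 0.
  move=> /eqP; rewrite psumr_eq0 => [/allP h k|k _]; last exact: sqr_ge0.
  by apply/eqP; rewrite -sqrf_eq0; apply: h; rewrite mem_index_enum.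
have [Az|An] := eqVneq A 0.
  rewrite Az mul0r big1 // => k _; rewrite (zero a) ?mul0r //.
  by rewrite EA Az expr0n.
have [Bz|Bn] := eqVneq B 0.
  rewrite Bz mulr0 big1 // => k _; rewrite (zero b) ?mulr0 //.
  by rewrite EB Bz expr0n.
have Ap : 0 < A by rewrite lt_neqAle eq_sym An sqrtr_ge0.
have Bp : 0 < B by rewrite lt_neqAle eq_sym Bn sqrtr_ge0.
(* [A] and [B] being the two norms, this sum of squares equals [2 * A * B] times the difference to
   be shown nonnegative. *)
have : 0 <= \sum_(k < d) (B * a k - A * b k) ^+ 2.
  by apply: sumr_ge0 => k _; exact: sqr_ge0.
have -> : \sum_(k < d) (B * a k - A * b k) ^+ 2 =
   (A * B) * 2 * (A * B - \sum_(k < d) a k * b k).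
  transitivity (B ^+ 2 * (\sum_(k < d) a k ^+ 2) + A ^+ 2 * (\sum_(k < d) b k ^+ 2)
     - 2 * A * B * \sum_(k < d) a k * b k).
    by rewrite !big_distrr /= -big_split -sumrB /=; apply: eq_bigr => k _; ring.
  by rewrite EA EB; ring.
by rewrite pmulr_rge0 ?subr_ge0 // !mulr_gt0.
Qed.

Lemma edist_euclid_triangle y x z : edist x z <= edist x y + edist y z.
Proof.
rewrite -[leRHS]ger0_norm ?addr_ge0 ?edist_ge0 // -sqrtr_sqr ler_wsqrtr //.
have S u v : 0 <= \sum_(k < d) (u ord0 k - v ord0 k) ^+ 2 :> R.
  by apply: sumr_ge0 => k _; exact: sqr_ge0.
rewrite sqrrD !sqr_sqrtr //.
have := cauchy_schwarz_sum (fun k => x ord0 k - y ord0 k) (fun k => y ord0 k - z ord0 k).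
rewrite -/(edist x y) -/(edist y z) => h.
have -> : \sum_(k < d) (x ord0 k - z ord0 k) ^+ 2 =
  \sum_(k < d) (x ord0 k - y ord0 k) ^+ 2 +
  2 * (\sum_(k < d) (x ord0 k - y ord0 k) * (y ord0 k - z ord0 k)) +
  \sum_(k < d) (y ord0 k - z ord0 k) ^+ 2.
  by rewrite big_distrr /= -!big_split /=; apply: eq_bigr => k _; ring.
rewrite -mulr_natl; lra.
Qed.

Lemma coord_le_edist x y k : `|x ord0 k - y ord0 k| <= edist x y.
Proof.
rewrite -sqrtr_sqr ler_wsqrtr // (bigD1 k) //= lerDl sumr_ge0 // => j _.
exact: sqr_ge0.
Qed.

Lemma edist_le_sup x y e : 0 <= e -> (forall k, `|x ord0 k - y ord0 k| <= e) ->
  edist x y <= d%:R * e.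
Proof.
move=> e0 h; have de : 0 <= d%:R * e by rewrite mulr_ge0.
rewrite -[leRHS]ger0_norm // -sqrtr_sqr ler_wsqrtr //.
apply: (@le_trans _ _ (\sum_(k < d) e ^+ 2)).
  by apply: ler_sum => k _; rewrite -real_normK ?num_real // lerXn2r ?nnegrE.
rewrite sumr_const card_ord -[_ *+ d]mulr_natl exprMn ler_wpM2r ?sqr_ge0 //.
by case: (d) => [|n]; rewrite ?mulr0n ?expr0n // -natrX ler_nat leq_pmulr.
Qed.

Lemma open_edistP (U : set 'rV[R]_d) :
  open U <-> forall x, U x -> exists2 e, 0 < e & forall y, edist x y < e -> U y.
Proof.
split=> [Uo x Ux|h].
  have : nbhs x U by exact: open_nbhs_nbhs.
  rewrite -nbhs_ballE => -[e /= e0 eU]; exists e => // y xy.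
  apply: eU; split=> // i k; rewrite ord1 /ball /=.
  exact: le_lt_trans (coord_le_edist x y k) xy.
rewrite openE => x /h [e e0 eU].
(* Adding 1 to [d] keeps the denominator positive when [d = 0] and makes the final comparison
   strict. *)
rewrite /interior -nbhs_ballE; exists (e / (d%:R + 1)) => /=.
  by rewrite divr_gt0 // ltr_wpDl.
move=> y [_ xy]; apply: eU.
have d1 : 0 < d%:R + 1 :> R by rewrite ltr_wpDl.
apply: (@le_lt_trans _ _ (d%:R * (e / (d%:R + 1)))).
  by apply: edist_le_sup => [|k]; [rewrite divr_ge0 // ltW|have := xy ord0 k; move/ltW].
by rewrite mulrA ltr_pdivrMr // mulrC ltr_pM2l // ltrDl.
Qed.

End euclidean_distance.

(** * Probabilities and finite partitions *)

Section real_probability.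
Context {disp : measure_display} {T : measurableType disp} {R : realType}.
Variable mu : probability T R.
Implicit Types (A B : set T).

Definition pr A : R := fine (mu A).

Lemma prE A : measurable A -> mu A = (pr A)%:E.
Proof. by move=> mA; rewrite /pr fineK // fin_num_measure. Qed.

Lemma pr_ge0 A : 0 <= pr A.
Proof. by rewrite /pr fine_ge0. Qed.

Lemma pr_setT : pr setT = 1.
Proof. by rewrite /pr probability_setT. Qed.

Lemma pr_set0 : pr set0 = 0.
Proof. by rewrite /pr measure0. Qed.

Lemma pr_le A B : measurable A -> measurable B -> A `<=` B -> pr A <= pr B.
Proof.
move=> mA mB AB; rewrite -lee_fin -!prE //.
by apply: le_measure => //; rewrite inE.
Qed.

Lemma pr_le1 A : measurable A -> pr A <= 1.
Proof. by move=> mA; rewrite -pr_setT; exact: pr_le. Qed.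

Lemma pr_setU A B : measurable A -> measurable B -> A `&` B = set0 ->
  pr (A `|` B) = pr A + pr B.
Proof.
move=> mA mB AB; apply: EFin_inj; rewrite EFinD -!prE //; last exact: measurableU.
by rewrite measureU.
Qed.

Lemma pr_setDI A B : measurable A -> measurable B ->
  pr A = pr (A `\` B) + pr (A `&` B).
Proof.
move=> mA mB; rewrite -pr_setU ?setDUK; last 3 first.
- exact: measurableD.
- exact: measurableI.
- by rewrite setDE setIACA setICl !setI0.
by rewrite setUC -{1}[A](setUIDK A B).
Qed.

Lemma pr_setC A : measurable A -> pr (~` A) = 1 - pr A.
Proof.
move=> mA; have := pr_setDI measurableT mA; rewrite pr_setT setTI setTD => ->.
by rewrite addrK.
Qed.

Lemma pr_setU_le A B : measurable A -> measurable B -> pr (A `|` B) <= pr A + pr B.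
Proof.
move=> mA mB; rewrite -lee_fin EFinD -!prE //; last exact: measurableU.
exact: measureU2.
Qed.

Lemma bigsetU_measurable_seq (I : Type) (s : seq I) (Q : pred I) (F : I -> set T) :
  (forall i, measurable (F i)) -> measurable (\big[setU/set0]_(i <- s | Q i) F i).
Proof. by move=> mF; apply: big_ind => //; exact: measurableU. Qed.

Lemma pr_bigsetU_le (I : Type) (s : seq I) (Q : pred I) (F : I -> set T) :
  (forall i, measurable (F i)) ->
  pr (\big[setU/set0]_(i <- s | Q i) F i) <= \sum_(i <- s | Q i) pr (F i).
Proof.
move=> mF; elim: s => [|a s IH]; first by rewrite !big_nil pr_set0.
rewrite !big_cons; case: ifP => // _; apply: (le_trans (pr_setU_le _ _)) => //.
  exact: bigsetU_measurable_seq.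
by rewrite lerD2l.
Qed.

Lemma pr_bigcup_cvg (F : (set T)^nat) : (forall n, measurable (F n)) ->
  {homo F : n m / (n <= m)%N >-> n `<=` m} ->
  forall e, 0 < e -> exists N, forall n, (N <= n)%N -> pr (\bigcup_n F n) - e < pr (F n).
Proof.
move=> mF ndF e e0; have mU : measurable (\bigcup_n F n) by exact: bigcupT_measurable.
have h : (mu \o F) x @[x --> \oo] --> (pr (\bigcup_n F n))%:E.
  rewrite -prE //; apply: nondecreasing_cvg_mu => // n m nm.
  by apply/subsetPset; exact: ndF.
have : (pr \o F) x @[x --> \oo] --> pr (\bigcup_n F n) by exact: fine_cvg h.
move=> /cvgrPdist_lt /(_ e e0) [N _ hN].
exists N => n /hN /=; rewrite -/(pr _) => H.
have := ler_norm (pr (\bigcup_n F n) - pr (F n)); lra.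
Qed.

(** The tail intersections [F n] increase to a set of full measure. Applied to local dimensions,
    this turns almost sure convergence into a statement about the mass of good points at a single
    scale. *)
Lemma pr_eventually (G : (set T)^nat) : (forall n, measurable (G n)) ->
  {ae mu, forall x, exists N, forall n, (N <= n)%N -> G n x} ->
  forall e, 0 < e -> exists N, forall n, (N <= n)%N -> 1 - e < pr (G n).
Proof.
move=> mG [A [mA A0 hA]] e e0.
pose F n := \bigcap_k G (n + k)%N.
have mF n : measurable (F n) by exact: bigcapT_measurable.
have [|N hN] := pr_bigcup_cvg mF _ e0.
  move=> n m nm x Fx k _; have := Fx (m - n + k)%N I.
  by rewrite addnA subnKC.
exists N => n Nn.
have h1 : 1 <= pr (\bigcup_n F n).
  have -> : 1 = pr (~` A) by rewrite pr_setC // /pr A0 /= subr0.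
  apply: pr_le; [exact: measurableC|exact: bigcupT_measurable|].
  move=> x nA; have /contrapT [M hM] : ~ ~ (exists N, forall n, (N <= n)%N -> G n x).
    by move=> h; apply: nA; exact: hA.
  by exists M => // k _; apply: hM; exact: leq_addr.
have h2 : pr (F n) <= pr (G n).
  by apply: pr_le => // x /(_ 0%N I); rewrite addn0.
have := hN n Nn; lra.
Qed.

End real_probability.

(** * Borel partitions, neighbourhoods and balls *)

Section partitions.
Context {R : realType} {d : nat}.
Variable mu : probability (Rd R d) R.
Implicit Types (A B : set (Rd R d)).

Lemma partition_measurable (m : nat) (D : 'I_m -> set (Rd R d)) j :
  borel_partition mu D -> measurable (D j).
Proof. by case. Qed.

Lemma bigcup_ord_bigsetU (m : nat) (D : 'I_m -> set (Rd R d)) :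
  \bigcup_(j in [set: 'I_m]) D j = \big[setU/set0]_(j < m) D j.
Proof.
rewrite -bigcup_seq; apply: eq_bigcupl; split => // j _ /=.
exact: mem_index_enum.
Qed.

(** Cells may overlap in null sets, so the cells are added one at a time, discarding the null
    intersection of the new cell with the union of the others. *)
Lemma pr_partition (m : nat) (D : 'I_m -> set (Rd R d)) A :
  borel_partition mu D -> measurable A ->
  pr mu A = \sum_(j < m) pr mu (A `&` D j).
Proof.
move=> [mD [D1 D0]] mA.
pose U (s : seq 'I_m) := \big[setU/set0]_(j <- s) D j.
have mU s : measurable (U s) by exact: bigsetU_measurable_seq.
have null j s : j \notin s -> pr mu (D j `&` U s) = 0.
  move=> js; apply/eqP; rewrite eq_le pr_ge0 andbT /U.
  rewrite (big_distrr (D j)) /=.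
  apply: (le_trans (pr_bigsetU_le _ _ _ _)) => [k|]; first exact: measurableI.
  rewrite big_seq big1 // => k ks; rewrite /pr D0 //.
  by apply: contraNneq js => ->.
have ind s : uniq s -> pr mu (A `&` U s) = \sum_(j <- s) pr mu (A `&` D j).
  elim: s => [_|j s IH /= /andP[js us]]; first by rewrite /U !big_nil setI0 pr_set0.
  rewrite big_cons -IH // {1}/U big_cons -/(U s).
  have mj := mD j; have mAj := measurableI _ _ mA mj.
  have mAU := measurableI _ _ mA (mU s).
  rewrite (@pr_setDI _ _ _ mu (A `&` (D j `|` U s)) (D j)) //; last first.
    by apply: measurableI => //; exact: measurableU.
  rewrite addrC; congr +%R.
    by congr (pr mu); apply/seteqP; split=> x /=; tauto.
  rewrite (@pr_setDI _ _ _ mu (A `&` U s) (D j)) //.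
  have -> : pr mu (A `&` U s `&` D j) = 0.
    apply/eqP; rewrite eq_le pr_ge0 andbT -(null j s js).
    apply: pr_le; [exact: measurableI|exact: measurableI|by move=> x [[]]].
  rewrite addr0; congr (pr mu); apply/seteqP; split=> x /=; tauto.
rewrite -[X in _ = X]ind ?index_enum_uniq //.
rewrite (@pr_setDI _ _ _ mu A (U (index_enum 'I_m))) //.
suff -> : pr mu (A `\` U (index_enum 'I_m)) = 0 by rewrite add0r.
apply/eqP; rewrite eq_le pr_ge0 andbT.
apply: (@le_trans _ _ (pr mu (~` U (index_enum 'I_m)))).
  by apply: pr_le; [exact: measurableD|exact: measurableC|move=> x []].
by rewrite pr_setC // /U -bigcup_ord_bigsetU /pr D1 /= subrr.
Qed.

Lemma pr_partition1 (m : nat) (D : 'I_m -> set (Rd R d)) :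
  borel_partition mu D -> \sum_(j < m) pr mu (D j) = 1.
Proof.
move=> DP; rewrite -(@pr_setT _ _ _ mu) (pr_partition DP) //.
by apply: eq_bigr => j _; rewrite setTI.
Qed.

Lemma disjoint_partition (m : nat) (D : 'I_m -> set (Rd R d)) :
  (forall j, measurable (D j)) -> mu (\bigcup_(j in [set: 'I_m]) D j) = 1%E ->
  (forall j k x, D j x -> D k x -> j = k) -> borel_partition mu D.
Proof.
move=> mD D1 Dd; split=> //; split=> // j k jk.
suff -> : D j `&` D k = set0 by rewrite measure0.
by apply/eqP/negPn/negP => /set0P[x [jx kx]]; move/eqP: jk; apply; exact: Dd jx kx.
Qed.

(** The strict inequality makes this set open, hence Borel for every [A]. *)
Definition thicken A (r : R) : set (Rd R d) :=
  [set y | exists2 x, A x & edist x y < r].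

Lemma open_measurable_Rd A : @open 'rV[R]_d A -> measurable A.
Proof. exact: sub_sigma_algebra. Qed.

Lemma open_thicken A r : @open 'rV[R]_d (thicken A r).
Proof.
apply/open_edistP => y [x Ax xy]; exists (r - edist x y); first by rewrite subr_gt0.
move=> z yz; exists x => //; have := edist_euclid_triangle y x z; lra.
Qed.

Lemma measurable_thicken A r : measurable (thicken A r).
Proof. apply: open_measurable_Rd; exact: open_thicken. Qed.

Lemma sub_thicken A r : 0 < r -> A `<=` thicken A r.
Proof. by move=> r0 x Ax; exists x => //; rewrite edistxx. Qed.

Lemma measurable_eball (x : Rd R d) r : measurable (eball x r).
Proof.
rewrite -(setCK (eball x r)); apply: measurableC; apply: open_measurable_Rd.
apply/open_edistP => y /negP; rewrite -ltNge => h.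
exists (edist x y - r); first by rewrite subr_gt0.
move=> z yz; apply/negP; rewrite -ltNge.
have := edist_euclid_triangle z x y; rewrite (edistC z y); lra.
Qed.

(* Upper semicontinuity of the mass of closed balls of a fixed radius. *)
Lemma measurable_pr_eball r : measurable_fun setT (fun x : Rd R d => pr mu (eball x r)).
Proof.
move=> mT; apply: (measurability _ (measurable_realfun.RGenCInfty.measurableE R)) => //.
move=> /= _ [_ [a ->] <-]; rewrite setTI.
have -> : (fun x => pr mu (eball x r)) @^-1` `[a, +oo[%classic =
          ~` [set x | pr mu (eball x r) < a].
  apply/seteqP; split=> x /=; rewrite in_itv /= andbT.
    by move=> ax; apply/negP; rewrite -leNgt.
  by move/negP; rewrite -leNgt.
apply: measurableC; apply: open_measurable_Rd; apply/open_edistP => x /= xa.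
(* The complements of slightly larger balls increase to the complement of [eball x r], so some
   larger ball still has mass below [a]; it contains the balls of radius [r] about all nearby
   points. *)
pose F n := ~` eball x (r + n.+1%:R^-1).
have mF n : measurable (F n) by apply: measurableC; exact: measurable_eball.
have [||N /(_ N (leqnn N)) hN] := @pr_bigcup_cvg _ _ _ mu F mF _ (a - pr mu (eball x r)).
- move=> n m nm y /= /negP; rewrite -ltNge => h; apply/negP; rewrite -ltNge.
  apply: le_lt_trans h; rewrite lerD2l lef_pV2 ?posrE // ler_nat; exact: nm.
- by rewrite subr_gt0.
have FE : \bigcup_n F n = ~` eball x r.
  apply/seteqP; split=> y.
    move=> [n _ /= /negP]; rewrite -ltNge => h; apply/negP; rewrite -ltNge.
    by apply: lt_trans h; rewrite ltrDl.
  move=> /negP; rewrite -ltNge => h.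
  have e0 : 0 < edist x y - r by rewrite subr_gt0.
  have [n hn] := ltr_add_invr e0.
  by exists n => //=; apply/negP; rewrite -ltNge; move: hn; rewrite add0r ltrBrDl.
rewrite FE /F !pr_setC in hN; try exact: measurable_eball.
exists N.+1%:R^-1 => // y.
move: (N.+1%:R^-1) hN => e hN xy.
apply: (@le_lt_trans _ _ (pr mu (eball x (r + e)))); last by lra.
apply: pr_le; [exact: measurable_eball|exact: measurable_eball|].
move=> z; rewrite /eball /= => yz; have := edist_euclid_triangle y x z; lra.
Qed.

End partitions.

(** * Approximation by fine partitions *)

Section fine_partitions.
Context {R : realType} {d : nat}.
Variable mu : probability (Rd R d) R.
Implicit Types (A B : set (Rd R d)).
Local Notation pr := (pr mu).

Definition cells_within (m : nat) (D : 'I_m -> set (Rd R d)) (r : R) :=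
  forall j x y, D j x -> D j y -> edist x y <= r.

(** The mass misplaced when all of [A] is allotted to [B] or to its complement, whichever is
    cheaper. *)
Definition split_mass A B := Num.min (pr (A `&` B)) (pr (A `\` B)).

(* [A] is approximated in measure by unions of cells of fine partitions, the
   cells being allotted to [A] or to its complement by majority. *)
Definition cell_approximable A := measurable A /\
  forall e, 0 < e -> exists2 r, 0 < r &
    forall (m : nat) (D : 'I_m -> set (Rd R d)), borel_partition mu D ->
      cells_within D r -> \sum_(j < m) split_mass (D j) A <= e.

Lemma split_mass_setU A B C : measurable A -> measurable B -> measurable C ->
  split_mass A (B `|` C) <= split_mass A B + split_mass A C.
Proof.
move=> mA mB mC; rewrite /split_mass.
have mBC := measurableU _ _ mB mC.
have h1 : pr (A `\` (B `|` C)) <= pr (A `\` B).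
  by apply: pr_le; [exact: measurableD|exact: measurableD|move=> x /= []; tauto].
have h2 : pr (A `\` (B `|` C)) <= pr (A `\` C).
  by apply: pr_le; [exact: measurableD|exact: measurableD|move=> x /= []; tauto].
have h3 : pr (A `&` (B `|` C)) <= pr (A `&` B) + pr (A `&` C).
  by rewrite setIUr; apply: pr_setU_le; exact: measurableI.
have g1 := pr_ge0 mu (A `&` B); have g2 := pr_ge0 mu (A `\` B).
have g3 := pr_ge0 mu (A `&` C); have g4 := pr_ge0 mu (A `\` C).
case: (leP (pr (A `&` B)) (pr (A `\` B))) => h4;
case: (leP (pr (A `&` C)) (pr (A `\` C))) => h5; rewrite ge_min; apply/orP;
 first [by left; lra | by right; lra].
Qed.

Lemma cell_approximable_setU A B :
  cell_approximable A -> cell_approximable B -> cell_approximable (A `|` B).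
Proof.
move=> [mA hA] [mB hB]; split; first exact: measurableU.
move=> e e0; have e20 : 0 < e / 2 by lra.
have [r1 r10 h1] := hA _ e20; have [r2 r20 h2] := hB _ e20.
exists (Num.min r1 r2); first by rewrite lt_min r10.
move=> m D DP Dr.
have := h1 m D DP _; have := h2 m D DP _.
have Dr2 : cells_within D r2.
  by move=> j x y Dx Dy; apply: (le_trans (Dr _ _ _ Dx Dy)); rewrite ge_min lexx orbT.
have Dr1 : cells_within D r1.
  by move=> j x y Dx Dy; apply: (le_trans (Dr _ _ _ Dx Dy)); rewrite ge_min lexx.
move=> /(_ Dr2) g2 /(_ Dr1) g1.
apply: (@le_trans _ _ (\sum_(j < m) (split_mass (D j) A + split_mass (D j) B))).
  by apply: ler_sum => j _; apply: split_mass_setU => //; exact: (partition_measurable _ DP).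
by rewrite big_split /=; lra.
Qed.

Lemma cell_approximable_set0 : cell_approximable set0.
Proof.
split=> // e e0; exists 1 => // m D DP _.
apply: (le_trans _ (ltW e0)); apply: sumr_le0 => j _.
by rewrite /split_mass setI0 pr_set0 ge_min lexx.
Qed.

Lemma cell_approximable_setC A : cell_approximable A -> cell_approximable (~` A).
Proof.
move=> [mA hA]; split; first exact: measurableC.
move=> e /hA [r r0 h]; exists r => // m D DP Dr.
apply: le_trans (h m D DP Dr); apply: ler_sum => j _.
by rewrite /split_mass setDE setCK minC -setDE.
Qed.

(** Replacing [B] by the larger [A] raises the split masses by at most the mass of the difference in
    each cell, hence by a small total. *)
Lemma cell_approximable_sub A : measurable A ->
  (forall e, 0 < e -> exists B, [/\ cell_approximable B, B `<=` A & pr A - e < pr B]) ->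
  cell_approximable A.
Proof.
move=> mA hA; split=> // e e0; have e20 : 0 < e / 2 by lra.
have [B [[mB hB] BA AB]] := hA _ e20.
have [r r0 h] := hB _ e20; exists r => // m D DP Dr.
have mD j : measurable (D j) := partition_measurable j DP.
have mAB := measurableD mA mB.
apply: (@le_trans _ _ (\sum_(j < m) (split_mass (D j) B + pr ((A `\` B) `&` D j)))).
  apply: ler_sum => j _; rewrite /split_mass.
  have h1 : pr (D j `&` A) <= pr (D j `&` B) + pr ((A `\` B) `&` D j).
    apply: (@le_trans _ _ (pr ((D j `&` B) `|` ((A `\` B) `&` D j)))); last first.
      by apply: pr_setU_le; exact: measurableI.
    apply: pr_le; [exact: measurableI|by apply: measurableU; exact: measurableI|].
    by move=> x /= [Dx Ax]; have [Bx|nBx] := pselect (B x); [left|right].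
  have h2 : pr (D j `\` A) <= pr (D j `\` B).
    apply: pr_le; [exact: measurableD|exact: measurableD|].
    by move=> x /= [Dx nAx]; split=> // /BA.
  have g := pr_ge0 mu ((A `\` B) `&` D j).
  case: (leP (pr (D j `&` B)) (pr (D j `\` B))) => h4; rewrite ge_min; apply/orP;
    first [by left; lra | by right; lra].
rewrite big_split /= -(pr_partition DP) //.
have := pr_setDI mu mA mB; rewrite (setIidr BA); have := h m D DP Dr; lra.
Qed.

Lemma cell_approximable_bigcup (A : (set (Rd R d))^nat) :
  (forall n, cell_approximable (A n)) -> cell_approximable (\bigcup_n A n).
Proof.
move=> hA; have mA n : measurable (A n) by case: (hA n).
apply: cell_approximable_sub; first exact: bigcupT_measurable.
move=> e e0.
pose B n := \big[setU/set0]_(i < n.+1) A i.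
have aB n : cell_approximable (B n).
  rewrite /B; apply: big_ind => //; first exact: cell_approximable_set0.
  exact: cell_approximable_setU.
have [|N hN] := @pr_bigcup_cvg _ _ _ mu B (fun n => (aB n).1) _ e e0.
  by move=> n m nm; apply: subset_bigsetU.
exists (B N); split=> //; first exact: bigsetU_bigcup.
by have := hN N (leqnn N); rewrite /B bigcup_bigsetU_bigcup.
Qed.

(** [U n] consists of the points at distance at least [1/(n+1)] from the complement. A small cell
    meeting [U N] lies inside [A] and is not split; the remaining cells meet [A] only in [A] minus
    [U N], whose mass is small. *)
Lemma cell_approximable_open A : @open 'rV[R]_d A -> cell_approximable A.
Proof.
move=> oA; have mA := open_measurable_Rd oA; split=> // e e0.
pose U n := ~` thicken (~` A) n.+1%:R^-1.
have mU n : measurable (U n) by apply: measurableC; exact: measurable_thicken.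
have [||N /(_ N (leqnn N)) hN] := @pr_bigcup_cvg _ _ _ mu U mU _ e.
- move=> n m nm x Ux [y Ay yx]; apply: Ux; exists y => //; apply: (lt_le_trans yx).
  by rewrite lef_pV2 ?posrE // ler_nat.
- by [].
have UA : U N `<=` A.
  by move=> x Ux; apply: contrapT => nAx; apply: Ux; exists x => //; rewrite edistxx.
have UE : \bigcup_n U n = A.
  apply/seteqP; split=> x.
    by move=> [n _ Ux]; apply: contrapT => nAx; apply: Ux; exists x => //; rewrite edistxx.
  move/open_edistP : oA => /(_ x) h /h [r r0 hr].
  have [n hn] := ltr_add_invr r0; exists n => // -[y nAy yx]; apply: nAy; apply: hr.
  by rewrite edistC; apply: (lt_trans yx); move: hn; rewrite add0r.
rewrite UE in hN.
(* Strictly below [1/(N+1)], to match the strict inequality in [thicken]. *)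
exists (N.+2%:R^-1) => // m D DP Dr.
have mD j : measurable (D j) := partition_measurable j DP.
have mAU := measurableD mA (mU N).
apply: (@le_trans _ _ (\sum_(j < m) pr ((A `\` U N) `&` D j))); last first.
  rewrite -(pr_partition DP) //.
  by have := pr_setDI mu mA (mU N); rewrite (setIidr UA); lra.
apply: ler_sum => j _; rewrite /split_mass ge_min.
have [[x [Dx Ux]]|nx] := pselect (exists x, D j x /\ U N x).
  apply/orP; right; rewrite (_ : _ `\` _ = set0) ?pr_set0 ?pr_ge0 //.
  apply/seteqP; split=> // y [Dy nAy]; apply: Ux; exists y => //.
  apply: (le_lt_trans (Dr _ _ _ Dy Dx)).
  by rewrite ltf_pV2 ?posrE // ltr_nat.
apply/orP; left; apply: pr_le; [exact: measurableI|exact: measurableI|].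
by move=> x [Dx Ax]; split=> //; split=> // Ux; apply: nx; exists x.
Qed.

(** The approximable sets form a sigma-algebra containing the open sets. *)
Lemma measurable_cell_approximable A : measurable A -> cell_approximable A.
Proof.
move: A; apply: smallest_sub => [|A]; last exact: cell_approximable_open.
split=> [|A|A]; first exact: cell_approximable_set0.
  by rewrite setTD; exact: cell_approximable_setC.
exact: cell_approximable_bigcup.
Qed.

End fine_partitions.

(** * Entropies of self-similar measures *)

Section self_similar_entropy.
Context {R : realType} {d l : nat}.
Variables (S : 'I_l -> Rd R d -> Rd R d) (rho p : 'I_l -> R).
Variable mu : probability (Rd R d) R.
Hypothesis S_sim : forall i, similarity_ratio (S i) (rho i).
Hypothesis p0 : forall i, 0 < p i.
Hypothesis p1 : \sum_(i < l) p i = 1.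
Hypothesis mu_ss : self_similar S p mu.
Implicit Types (A B : set (Rd R d)).
Local Notation pr := (pr mu).

Lemma ratio01 i : 0 < rho i < 1.
Proof. by case: (S_sim i). Qed.

Lemma edist_similarity i x y : edist (S i x) (S i y) = rho i * edist x y.
Proof. by case: (S_sim i). Qed.

Lemma measurable_preimage_similarity i A : measurable A -> measurable (S i @^-1` A).
Proof.
move: A; apply: smallest_sub => [|U oU /=].
  split=> [|A|A] /=; first by rewrite preimage_set0.
    by rewrite setTD preimage_setC; exact: measurableC.
  by rewrite preimage_bigcup; exact: bigcupT_measurable.
apply: open_measurable_Rd; apply/open_edistP => x Ux.
move/open_edistP : oU => /(_ _ Ux) [e e0 he].
have [r0 r1] := andP (ratio01 i).
exists (e / rho i); first exact: divr_gt0.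
move=> y xy; apply: he; rewrite edist_similarity mulrC.
by rewrite -ltr_pdivlMr.
Qed.

Lemma pr_self_similar A : measurable A -> pr A = \sum_(i < l) p i * pr (S i @^-1` A).
Proof.
move=> mA; apply: EFin_inj; rewrite -sumEFin -prE // mu_ss //.
apply: eq_bigr => i _; rewrite EFinM -prE //; exact: measurable_preimage_similarity.
Qed.

Lemma pr_preimage_le i A : measurable A -> p i * pr (S i @^-1` A) <= pr A.
Proof.
move=> mA; rewrite [leRHS]pr_self_similar // (bigD1 i) //= lerDl sumr_ge0 // => k _.
by rewrite mulr_ge0 ?pr_ge0 // ltW.
Qed.

Lemma pr_preimage_full i A : measurable A -> pr A = 1 -> pr (S i @^-1` A) = 1.
Proof.
move=> mA A1; have := pr_preimage_le i (measurableC mA).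
rewrite preimage_setC (pr_setC _ mA) A1 subrr.
rewrite (pr_setC _ (measurable_preimage_similarity i mA)).
rewrite pmulr_rle0 // => h; apply/eqP; rewrite eq_le pr_le1 //.
  by rewrite /=; lra.
exact: measurable_preimage_similarity.
Qed.

(** Since [p i > 0], [pr_preimage_le] pulls null sets back to null sets; both the uncovered part and
    the overlaps stay null. *)
Lemma partition_preimage i (m : nat) (D : 'I_m -> set (Rd R d)) :
  borel_partition mu D -> borel_partition mu (fun j => S i @^-1` D j).
Proof.
move=> [mD [D1 D0]]; split; first by move=> j; exact: measurable_preimage_similarity.
have mU : measurable (\bigcup_(j in [set: 'I_m]) D j).
  by rewrite bigcup_ord_bigsetU; exact: bigsetU_measurable_seq.
split=> [|j k jk].
  rewrite -preimage_bigcup prE; last exact: measurable_preimage_similarity.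
  by rewrite pr_preimage_full // /pr D1.
rewrite -preimage_setI prE; last by apply: measurable_preimage_similarity; exact: measurableI.
congr EFin; apply/eqP; rewrite eq_le pr_ge0 andbT.
have := pr_preimage_le i (measurableI _ _ (mD j) (mD k)).
by rewrite {2}/pr D0 //= pmulr_rle0.
Qed.

(** The joint mass of having first symbol [i] and lying in [A]. *)
Definition cell_weights A (i : 'I_l) : R := p i * pr (S i @^-1` A).

Lemma cell_weights_ge0 A i : 0 <= cell_weights A i.
Proof. by rewrite mulr_ge0 ?pr_ge0 // ltW. Qed.

Lemma sum_cell_weights (m : nat) (D : 'I_m -> set (Rd R d)) i :
  borel_partition mu D -> \sum_(j < m) cell_weights (D j) i = p i.
Proof.
by move=> DP; rewrite -big_distrr /= (pr_partition1 (partition_preimage i DP)) mulr1.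
Qed.

Lemma part_sumE (m : nat) (D : 'I_m -> set (Rd R d)) :
  part_sum S p mu D = \sum_(j < m) fent (cell_weights (D j)).
Proof. by []. Qed.

Definition partition_entropy (m : nat) (D : 'I_m -> set (Rd R d)) : R :=
  \sum_(j < m) phi (pr (D j)).

Lemma partition_entropy_ge0 (m : nat) (D : 'I_m -> set (Rd R d)) :
  borel_partition mu D -> 0 <= partition_entropy D.
Proof.
move=> [mD _]; apply: sumr_ge0 => j _; apply: phi_ge0.
by rewrite pr_ge0 pr_le1.
Qed.

(* Chain rule: the entropy of [D] joined with the partition by the first
   symbol, computed in both orders. *)
Lemma partition_entropy_rec (m : nat) (D : 'I_m -> set (Rd R d)) :
  borel_partition mu D ->
  partition_entropy D = entropy p - part_sum S p mu D +
    \sum_(i < l) p i * partition_entropy (fun j => S i @^-1` D j).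
Proof.
move=> DP; have mD j := partition_measurable j DP.
have -> : part_sum S p mu D =
    \sum_(j < m) \sum_(i < l) phi (cell_weights (D j) i) - partition_entropy D.
  rewrite part_sumE /partition_entropy -sumrB; apply: eq_bigr => j _.
  rewrite fentE; last exact: cell_weights_ge0.
  by rewrite -pr_self_similar.
have -> : \sum_(j < m) \sum_(i < l) phi (cell_weights (D j) i) =
    \sum_(i < l) p i * partition_entropy (fun j => S i @^-1` D j) + entropy p.
  rewrite exchange_big /= /entropy -big_split /=; apply: eq_bigr => i _.
  under eq_bigr do rewrite phiM ?pr_ge0 ?(ltW (p0 i)) //.
  rewrite big_split /= -big_distrr -big_distrl /=.
  by rewrite (pr_partition1 (partition_preimage i DP)) mul1r phiE.
lra.
Qed.

(* A discrete substitute for [- \int ln (mu (ball x r)) dmu(x)]. *)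
Definition thick_entropy (r : R) (m : nat) (D : 'I_m -> set (Rd R d)) : R :=
  \sum_(j < m) pr (D j) * - ln (pr (thicken (D j) r)).

Lemma thicken_preimage_sub i A r : 
  thicken (S i @^-1` A) (r / rho i) `<=` S i @^-1` (thicken A r).
Proof.
have [r0 _] := andP (ratio01 i).
move=> y [x Ax xy]; exists (S i x) => //.
by rewrite edist_similarity mulrC -ltr_pdivlMr.
Qed.

(** Gibbs' inequality compares the weights of a cell with those of its neighbourhood, whose total
    mass is the one recorded in [thick_entropy]. The neighbourhood pulled back by [S i] contains the
    [r / rho i]-neighbourhood of the pulled-back cell, which bounds the remaining logarithms. *)
Lemma thick_entropy_rec (r : R) (m : nat) (D : 'I_m -> set (Rd R d)) :
  0 < r -> borel_partition mu D ->
  thick_entropy r D <= entropy p - part_sum S p mu D +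
    \sum_(i < l) p i * thick_entropy (r / rho i) (fun j => S i @^-1` D j).
Proof.
move=> r0 DP; have mD j := partition_measurable j DP.
pose b j := cell_weights (thicken (D j) r).
have mb j : measurable (thicken (D j) r) by exact: measurable_thicken.
have bE j : \sum_(i < l) b j i = pr (thicken (D j) r) by rewrite -pr_self_similar.
have wb j i : cell_weights (D j) i <= b j i.
  rewrite ler_pM2l // pr_le //; [exact: measurable_preimage_similarity| | ].
    exact: measurable_preimage_similarity.
  by apply: preimage_subset; exact: sub_thicken.
have key j : pr (D j) * - ln (pr (thicken (D j) r)) <=
    - fent (cell_weights (D j)) + \sum_(i < l) cell_weights (D j) i * - ln (b j i).
  have := @fent_le_cross _ _ (cell_weights (D j)) (b j) (cell_weights_ge0 _) (cell_weights_ge0 _).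
  rewrite bE => /(_ _)/wrap[i|]; first by move/lt_le_trans; apply.
  under eq_bigr do rewrite mulrBr.
  rewrite sumrB -big_distrl /= -pr_self_similar //.
  under [in X in _ -> X]eq_bigr do rewrite mulrN.
  rewrite sumrN; lra.
have key2 j i : cell_weights (D j) i * - ln (b j i) <= cell_weights (D j) i * - ln (p i) +
    cell_weights (D j) i * - ln (pr (thicken (S i @^-1` D j) (r / rho i))).
  have [->|wn0] := eqVneq (cell_weights (D j) i) 0; first by rewrite !mul0r addr0.
  have wp : 0 < cell_weights (D j) i by rewrite lt_neqAle eq_sym wn0 cell_weights_ge0.
  have prp : 0 < pr (S i @^-1` D j) by move: wp; rewrite pmulr_rgt0.
  have [ri0 _] := andP (ratio01 i).
  have tp : 0 < pr (thicken (S i @^-1` D j) (r / rho i)).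
    apply: (lt_le_trans prp); apply: pr_le; [exact: measurable_preimage_similarity| |].
      exact: measurable_thicken.
    by apply: sub_thicken; exact: divr_gt0.
  have h : pr (thicken (S i @^-1` D j) (r / rho i)) <= pr (S i @^-1` thicken (D j) r).
    apply: pr_le; [exact: measurable_thicken|exact: measurable_preimage_similarity|].
    exact: thicken_preimage_sub.
  rewrite -mulrDr ler_pM2l // -opprD lerN2 -lnM ?posrE // ler_ln ?posrE ?mulr_gt0 //.
    by rewrite ler_pM2l.
  exact: lt_le_trans tp h.
apply: (@le_trans _ _ (\sum_(j < m) (- fent (cell_weights (D j)) +
   \sum_(i < l) (cell_weights (D j) i * - ln (p i) +
    cell_weights (D j) i * - ln (pr (thicken (S i @^-1` D j) (r / rho i))))))).
  apply: ler_sum => j _; apply: (le_trans (key j)); rewrite lerD2l.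
  by apply: ler_sum => i _.
rewrite big_split /= sumrN -part_sumE exchange_big /=.
have -> : \sum_(i < l) \sum_(j < m) (cell_weights (D j) i * - ln (p i) +
    cell_weights (D j) i * - ln (pr (thicken (S i @^-1` D j) (r / rho i)))) =
   entropy p + \sum_(i < l) p i * thick_entropy (r / rho i) (fun j => S i @^-1` D j).
  rewrite /entropy -big_split /=; apply: eq_bigr => i _.
  rewrite big_split /= -big_distrl /= sum_cell_weights // mulrN; congr +%R.
  by rewrite /thick_entropy big_distrr /=; apply: eq_bigr => j _; rewrite /cell_weights mulrA.
lra.
Qed.

(** Each cell of [D] is allotted to a cell of [D0]. Superadditivity merges the cells allotted to
    [D0 k]; the merged weights exceed those of [D0 k] by at most the misallotted mass, which
    [fent_shift_le] tolerates. *)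
Lemma part_sum_fine (m0 : nat) (D0 : 'I_m0 -> set (Rd R d)) e :
  borel_partition mu D0 -> 0 < e ->
  exists2 r, 0 < r & forall (m : nat) (D : 'I_m -> set (Rd R d)),
    borel_partition mu D -> cells_within D r ->
    part_sum S p mu D <= part_sum S p mu D0 + e.
Proof.
move=> DP0 e0.
(* t^2 bounds the mass misallotted when the cells of D are attributed to those of D0 *)
pose t := Num.min (l%:R + 1)^-1 (e / (4 * (m0%:R + 1) * (l%:R + 1))).
have l1 : 0 < l%:R + 1 :> R by rewrite ltr_wpDl.
have m1 : 0 < m0%:R + 1 :> R by rewrite ltr_wpDl.
have t0 : 0 < t by rewrite lt_min invr_gt0 l1 divr_gt0 // !mulr_gt0.
have tl : t * (l%:R + 1) <= 1.
  by rewrite -ler_pdivlMr // mul1r ge_min lexx.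
have te : t * (4 * (m0%:R + 1) * (l%:R + 1)) <= e.
  by rewrite -ler_pdivlMr ?mulr_gt0 // ge_min lexx orbT.
have t1 : t <= 1.
  by apply: le_trans tl; rewrite ler_peMr ?(ltW t0) // lerDr.
have tt : t ^+ 2 <= t by rewrite expr2 ler_piMr // ltW.
have mD0 k := partition_measurable k DP0.
have [r r0 hr] : exists2 r, 0 < r & forall (m : nat) (D : 'I_m -> set (Rd R d)),
    borel_partition mu D -> cells_within D r ->
    \sum_(k < m0) \sum_(j < m) split_mass mu (D j) (D0 k) <= t ^+ 2.
  have e' : 0 < t ^+ 2 / (m0%:R + 1) by rewrite divr_gt0 // exprn_gt0.
  have H k := (measurable_cell_approximable mu (mD0 k)).2 _ e'.
  pose r := \big[Num.min/1]_(k < m0) s2val (cid2 (H k)).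
  exists r; first by rewrite /r; elim/big_ind : _ => // [x y x0 y0|k _];
     [rewrite lt_min x0|exact: (s2valP (cid2 (H k)))].
  move=> m D DP Dr.
  apply: (@le_trans _ _ (\sum_(k < m0) t ^+ 2 / (m0%:R + 1))).
    apply: ler_sum => k _; apply: (s2valP' (cid2 (H k))) => // j x y Dx Dy.
    apply: (le_trans (Dr _ _ _ Dx Dy)); exact: bigmin_le_cond.
  rewrite sumr_const card_ord -[_ *+ _]mulr_natr mulrAC ler_pdivrMr //.
  by rewrite ler_wpM2l ?sqr_ge0 // lerDl.
exists r => // m D DP Dr; have mD j := partition_measurable j DP.
have {hr Dr} hsplit := hr m D DP Dr.
have m0p : (0 < m0)%N.
  rewrite lt0n; apply/eqP => m0E; have := pr_partition1 DP0; rewrite big1.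
    by move/eqP; rewrite eq_sym oner_eq0.
  by move=> k _; have := ltn_ord k; rewrite {2}m0E ltn0.
pose k0 := Ordinal m0p.
(* When no cell of [D0] holds half of [D j], the split masses are the full intersections and sum to
   [pr (D j)], so the default [k0] costs no more than they do. *)
pose a j := odflt k0 [pick k | pr (D j `\` D0 k) <= pr (D j `&` D0 k)].
have aP j : pr (D j `\` D0 (a j)) <= \sum_(k < m0) split_mass mu (D j) (D0 k).
  have sm0 k : 0 <= split_mass mu (D j) (D0 k) by rewrite /split_mass le_min !pr_ge0.
  rewrite /a; case: pickP => [k hk|hno] /=.
    by rewrite (bigD1 k) //= {1}/split_mass (min_idPr hk) lerDl sumr_ge0.
  apply: (@le_trans _ _ (pr (D j))).
    by apply: pr_le; [exact: measurableD|exact: mD|exact: subDsetl].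
  rewrite (pr_partition DP0) //; apply: ler_sum => k _.
  rewrite /split_mass le_min lexx /= ltW // ltNge; exact/negbT/hno.
have merge k i : \sum_(j | a j == k) cell_weights (D j) i <= cell_weights (D0 k) i + t ^+ 2.
  have pull j := pr_setDI mu (measurable_preimage_similarity i (mD j))
                  (measurable_preimage_similarity i (mD0 k)).
  rewrite /cell_weights; under eq_bigr do rewrite pull mulrDr.
  rewrite big_split /= addrC; apply: lerD.
    rewrite -big_distrr ler_pM2l //=.
    rewrite [leRHS](pr_partition (partition_preimage i DP)); last exact: measurable_preimage_similarity.
    rewrite [leRHS](bigID (fun j => a j == k)) /=.
    under eq_bigr do rewrite setIC.
    by rewrite lerDl sumr_ge0 // => j _; exact: pr_ge0.
  apply: (@le_trans _ _ (\sum_(j < m) pr (D j `\` D0 (a j)))).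
    rewrite [leRHS](bigID (fun j => a j == k)) /=.
    rewrite -[leLHS]addr0; apply: lerD; last by apply: sumr_ge0 => j _; exact: pr_ge0.
    apply: ler_sum => j /eqP <-.
    exact: (pr_preimage_le i (measurableD (mD j) (mD0 (a j)))).
  by apply: le_trans hsplit; rewrite exchange_big; apply: ler_sum => j _; exact: aP.
rewrite !part_sumE (partition_big a predT) //=.
apply: (@le_trans _ _ (\sum_(k < m0) (fent (cell_weights (D0 k)) + l%:R * (2 * t + 2 * t ^+ 2)))).
  apply: ler_sum => k _.
  apply: le_trans (fent_superadditive _ _) _; first by move=> j i; exact: cell_weights_ge0.
  apply: le_trans (fent_le _ (merge k)) _.
    by move=> i; apply: sumr_ge0 => j _; exact: cell_weights_ge0.
  apply: fent_shift_le; [exact: cell_weights_ge0|exact: ltW|].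
  rewrite -pr_self_similar //; have := pr_le1 mu (mD0 k).
  have : l%:R * t ^+ 2 <= l%:R * t by rewrite ler_wpM2l.
  lra.
rewrite big_split /= sumr_const card_ord lerD2l -[_ *+ _]mulr_natl.
apply: le_trans te.
apply: (@le_trans _ _ ((m0%:R + 1) * ((l%:R + 1) * (4 * t)))); last by rewrite le_eqVlt; apply/orP; left; apply/eqP; ring.
apply: ler_pM => //; rewrite ?lerDl //; first by rewrite !mulr_ge0 // addr_ge0 ?mulr_ge0 ?sqr_ge0 // ltW.
apply: ler_pM => //; rewrite ?lerDl //; first by rewrite addr_ge0 ?mulr_ge0 ?sqr_ge0 // ltW.
lra.
Qed.

End self_similar_entropy.

(** * Bounded support and economical partitions *)

Lemma ratio_bounds {R : realType} {l : nat} (rho : 'I_l -> R) :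
  (forall i, 0 < rho i < 1) -> exists rmin rmax : R,
    [/\ 0 < rmin, 0 < rmax < 1, forall i, rmin <= rho i & forall i, rho i <= rmax].
Proof.
(* Starting from [2^-1] keeps both extrema in the open unit interval, even over an empty family. *)
move=> rho01; exists (\big[Num.min/2^-1]_(i < l) rho i), (\big[Num.max/2^-1]_(i < l) rho i).
have half : 0 < (2^-1 : R) < 1 by lra.
split.
- elim/big_ind : _ => [|x y x0 y0|i _]; [lra|by rewrite lt_min x0|].
  by case/andP: (rho01 i).
- apply: (big_ind (fun x : R => is_true (0 < x < 1))) => // x y /andP[x0 x1] /andP[y0 y1].
  by rewrite lt_max x0 gt_max x1 y1.
- by move=> i; apply: bigmin_le_cond.
- by move=> i; apply: le_bigmax_cond.
Qed.

Section support.
Context {R : realType} {d l : nat}.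
Variables (S : 'I_l -> Rd R d -> Rd R d) (rho p : 'I_l -> R).
Variable mu : probability (Rd R d) R.
Hypothesis S_sim : forall i, similarity_ratio (S i) (rho i).
Hypothesis p0 : forall i, 0 < p i.
Hypothesis p1 : \sum_(i < l) p i = 1.
Hypothesis mu_ss : self_similar S p mu.
Variable rmax : R.
Hypothesis rmax01 : 0 < rmax < 1.
Hypothesis rmaxP : forall i, rho i <= rmax.
Local Notation pr := (pr mu).

(** By self-similarity [pr B] is the [p]-average of the masses of its preimages, each at least
    [pr A]. *)
Lemma pr_le_of_preimages (A B : set (Rd R d)) : measurable A -> measurable B ->
  (forall i, A `<=` S i @^-1` B) -> pr A <= pr B.
Proof.
move=> mA mB AB; rewrite (pr_self_similar S_sim mu_ss mB).
rewrite -[leLHS]mul1r -p1 big_distrl /=; apply: ler_sum => i _.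
rewrite ler_pM2l //; apply: pr_le => //.
exact: (measurable_preimage_similarity S_sim).
Qed.

(** Every [S i] maps the ball of radius [r] about 0 into that of radius [rmax * r + C], so this
    change of radius does not lose mass. Iterating it drives any radius below [K + 1], where [K] is
    the fixed point. *)
Lemma bounded_support : exists2 M, 0 < M & pr (eball (0 : Rd R d) M) = 1.
Proof.
have [r0 r1] := andP rmax01.
pose C := \sum_(i < l) edist 0 (S i 0).
have C0 : 0 <= C by apply: sumr_ge0 => i _; exact: edist_ge0.
pose K := C / (1 - rmax).
have K0 : 0 <= K by rewrite divr_ge0 // subr_ge0 ltW.
have KE : rmax * K + C = K.
  have : K * (1 - rmax) = C by rewrite mulfVK // gt_eqF // subr_gt0.
  lra.
have step r : 0 <= r -> pr (eball (0 : Rd R d) r) <= pr (eball (0 : Rd R d) (rmax * r + C)).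
  move=> rp; apply: pr_le_of_preimages; [exact: measurable_eball|exact: measurable_eball|].
  move=> i x; rewrite /eball /= => xr.
  have := edist_euclid_triangle (S i 0) 0 (S i x); rewrite (edist_similarity S_sim).
  have : edist 0 (S i 0) <= C.
    by rewrite /C (bigD1 i) //= lerDl sumr_ge0 // => k _; exact: edist_ge0.
  have : rho i * edist 0 x <= rmax * r.
    by apply: ler_pM => //; [case/andP: (ratio01 S_sim i) => /ltW|exact: edist_ge0].
  lra.
have iter r n : 0 <= r -> pr (eball (0 : Rd R d) r) <=
    pr (eball (0 : Rd R d) (r * rmax ^+ n + K)).
  move=> rp; elim: n => [|n IH].
    apply: pr_le; [exact: measurable_eball|exact: measurable_eball|].
    by move=> x; rewrite /eball /= expr0 mulr1 => h; lra.
  apply: (le_trans IH).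
  have -> : r * rmax ^+ n.+1 + K = rmax * (r * rmax ^+ n + K) + C.
    by rewrite -{1}KE exprS; ring.
  by apply: step; rewrite addr_ge0 // mulr_ge0 // exprn_ge0 // ltW.
exists (K + 1); first lra.
have allr (n : nat) : pr (eball (0 : Rd R d) n%:R) <= pr (eball (0 : Rd R d) (K + 1)).
  have rm : 0 <= rmax < 1 by rewrite ltW.
  have [N /(_ N (leqnn N)) hN] := expr_eventually_lt rm (ler0n R n) (@ltr01 R).
  apply: (le_trans (iter n%:R N _)); first exact: ler0n.
  apply: pr_le; [exact: measurable_eball|exact: measurable_eball|].
  move=> x; rewrite /eball /=; lra.
apply/eqP; rewrite eq_le pr_le1 /=; last exact: measurable_eball.
apply/ler_addgt0Pl => e e0.
have mF n : measurable (eball (0 : Rd R d) n%:R) by exact: measurable_eball.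
have [|N /(_ N (leqnn N)) hN] := @pr_bigcup_cvg _ _ _ mu _ mF _ e e0.
  move=> n m nm x; rewrite /eball /= => h; apply: (le_trans h).
  by rewrite ler_nat.
have UT : \bigcup_n eball (0 : Rd R d) n%:R = setT.
  apply/seteqP; split=> // x _.
  exists (Num.truncn (edist 0 x)).+1 => //; rewrite /eball /=.
  exact/ltW/truncnS_gt.
rewrite UT pr_setT in hN.
have := allr N; lra.
Qed.

(** The centres are the images of 0 under compositions of [n] maps: the images of a cover of full
    mass under all [S i] again have full mass. *)
Lemma ball_cover M n : pr (eball (0 : Rd R d) M) = 1 ->
  exists (I : finType) (c : I -> Rd R d),
    #|I| = (l ^ n)%N /\
    pr (\big[setU/set0]_(i : I) eball (c i) (M * rmax ^+ n)) = 1.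
Proof.
move=> M1; have mb x r : measurable (eball (x : Rd R d) r) by exact: measurable_eball.
elim: n => [|n [I [c [cI c1]]]].
  exists unit, (fun=> 0); rewrite card_unit; split => //.
  by rewrite (big_pred1 tt) ?expr0 ?mulr1 // => -[].
exists ('I_l * I)%type, (fun q => S q.1 (c q.2)); split.
  by rewrite card_prod card_ord cI expnS.
apply/eqP; rewrite eq_le pr_le1 /=; last exact: bigsetU_measurable_seq.
rewrite -c1; apply: pr_le_of_preimages; [exact: bigsetU_measurable_seq|exact: bigsetU_measurable_seq|].
move=> i x; rewrite -!bigcup_seq => -[k _]; rewrite /eball /= => kx.
exists (i, k) => /=; first exact: mem_index_enum.
rewrite (edist_similarity S_sim) exprS mulrCA.
apply: ler_pM => //; first by case/andP: (ratio01 S_sim i) => /ltW.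
exact: edist_ge0.
Qed.

(** Subtracting the earlier sets gives strict disjointness, on which [merge_cells] relies. *)
Lemma cover_partition (m : nat) (A : 'I_m -> set (Rd R d)) :
  (forall j, measurable (A j)) -> pr (\big[setU/set0]_(j < m) A j) = 1 ->
  exists D : 'I_m -> set (Rd R d), [/\ borel_partition mu D,
    forall j k x, D j x -> D k x -> j = k & forall j, D j `<=` A j].
Proof.
move=> mA A1.
pose D (j : 'I_m) := A j `\` \big[setU/set0]_(k < m | (k < j)%N) A k.
have mD j : measurable (D j).
  by apply: measurableD => //; exact: bigsetU_measurable_seq.
have notin (j k : 'I_m) x : (k < j)%N -> A k x -> D j x -> False.
  by move=> kj Ax [_]; apply; rewrite (bigD1 k) //=; left.
have Dd j k x : D j x -> D k x -> j = k.
  move=> Dj Dk; have [jk|kj|//] := ltngtP j k; last exact: val_inj.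
    by exfalso; apply: (notin k j x) => //; case: Dj.
  by exfalso; apply: (notin j k x) => //; case: Dk.
exists D; split => //; last by move=> j x [].
apply: disjoint_partition => //; rewrite prE; last first.
  by rewrite bigcup_ord_bigsetU; exact: bigsetU_measurable_seq.
congr EFin; rewrite -[RHS]A1; congr (pr _); rewrite bigcup_ord_bigsetU -!bigcup_seq.
apply/seteqP; split=> x [j jm] => [[Ax _]|Ax]; first by exists j.
have [k /asboolP Ak kmin] := @arg_minnP _ j (fun k => `[< A k x >]) (@nat_of_ord m) (asboolT Ax).
exists k; first exact: mem_index_enum.
split=> //; rewrite -bigcup_seq_cond => -[i /= /andP[_ ik] Ai].
by have := kmin i (asboolT Ai); rewrite leqNgt ik.
Qed.

(** The number of cells matters: its logarithm is linear in [n], hence comparable to [- ln] of the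
    scale, so that a small exceptional mass contributes little entropy in [dim_ge]. *)
Lemma fine_partition : exists2 K, 0 < K & forall n,
  exists D : 'I_(l ^ n) -> set (Rd R d), [/\ borel_partition mu D,
    forall j k x, D j x -> D k x -> j = k & cells_within D (K * rmax ^+ n)].
Proof.
have [M M0 M1] := bounded_support.
exists (2 * M) => [|n]; first lra.
have [I [c [cI c1]]] := ball_cover n M1.
rewrite -cI.
have [||D [DP Dd DA]] := @cover_partition #|I| (fun j => eball (c (enum_val j)) (M * rmax ^+ n)).
- by move=> j; exact: measurable_eball.
- by rewrite -c1 [in RHS](reindex _ (onW_bij _ (@enum_val_bij I))).
exists D; split=> // j x y /DA; rewrite /eball /= => hx /DA; rewrite /eball /= => hy.
have := edist_euclid_triangle (c (enum_val j)) x y.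
rewrite (edistC x (c _)); lra.
Qed.

End support.

(** * Merging cells around separated centres *)

Section merging.
Context {R : realType} {d : nat}.
Variable mu : probability (Rd R d) R.
Local Notation pr := (pr mu).

Lemma sum_pr_disjoint_le1 (I : eqType) (s : seq I) (B : I -> set (Rd R d)) :
  uniq s -> (forall i, measurable (B i)) ->
  (forall i j x, i \in s -> j \in s -> B i x -> B j x -> i = j) ->
  \sum_(i <- s) pr (B i) <= 1.
Proof.
move=> us mB Bd.
apply: (@le_trans _ _ (pr (\big[setU/set0]_(i <- s) B i))); last first.
  by apply: pr_le1; exact: bigsetU_measurable_seq.
elim: s us Bd => [_ _|a s IH /= /andP[as_ us] Bd]; first by rewrite !big_nil pr_set0.
rewrite !big_cons pr_setU //; last first.
- apply/eqP/negPn/negP => /set0P[x [Ba]]; rewrite big_seq.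
  elim/big_ind : _ => [//|A A' hA hA' [|]//|i si Bi].
  have := Bd a i x; rewrite mem_head in_cons si orbT => /(_ isT isT Ba Bi) ai.
  by move: as_; rewrite ai si.
- exact: bigsetU_measurable_seq.
rewrite lerD2l IH // => i j x si sj; apply: Bd; rewrite in_cons ?si ?sj orbT //.
Qed.

(* A maximal 2q-separated family of centres in heavy cells has at most 1/a
   members; merging every heavy cell with a nearby centre leaves few cells. *)
Lemma merge_cells (m : nat) (D : 'I_m -> set (Rd R d)) (good : {set 'I_m})
    (c : 'I_m -> Rd R d) (r q a : R) :
  borel_partition mu D -> (forall j k x, D j x -> D k x -> j = k) ->
  cells_within D r -> 0 <= r -> 0 <= q -> 0 < a ->
  good != finset.set0 ->
  (forall j, j \in good -> D j (c j) /\ a <= pr (eball (c j) q)) ->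
  exists D' : 'I_m -> set (Rd R d), [/\ borel_partition mu D',
    cells_within D' (4 * q + 2 * r) &
    partition_entropy mu D' <=
      - ln a + (\sum_(j in (~: good)%SET) pr (D j)) * ln m%:R + 2].
Proof.
move=> DP Dd Dr r0 q0 a0 /set0Pn[j0 j0good] goodP.
have mD j := partition_measurable j DP.
pose sep (I : {set 'I_m}) := (I \subset good) &&
  [forall j in I, forall k in I, (j != k) ==> (2 * q < edist (c j) (c k))].
have sep0 : sep finset.set0.
  by rewrite /sep finset.sub0set /=; apply/forall_inP => j; rewrite inE.
have [I /maxsetP[/andP[Igood /forall_inP Isep] Imax] _] := maxset_exists sep0.
(* A good cell whose centre is far from all of [I] could be added to [I], against maximality. *)
have near j : j \in good -> exists k, (k \in I) && (edist (c j) (c k) <= 2 * q).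
  move=> jg; apply: contrapT => /forallNP far.
  have jI : j \in I.
    suff <- : (j |: I)%SET = I by rewrite finset.setU11.
    apply: Imax; last exact: finset.subsetUr.
    rewrite /sep finset.subUset finset.sub1set jg Igood /=.
    apply/forall_inP => u; rewrite !inE => uP; apply/forall_inP => v; rewrite !inE => vP.
    apply/implyP => uv; case/predU1P: uP => [uj|uI]; case/predU1P: vP => [vj|vI].
    - by move: uv; rewrite uj vj eqxx.
    - by have := far v; rewrite vI /= uj => /negP; rewrite -ltNge.
    - by have := far u; rewrite uI /= vj edistC => /negP; rewrite -ltNge.
    - by move/forall_inP: (Isep u uI) => /(_ v vI) /implyP; apply.
  by apply: (far j); rewrite jI /= edistxx mulr_ge0.
(* Good cells move to a nearby centre of [I], which exists by [near]; the others stay alone. *)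
pose ctr j := if j \in good then odflt j [pick k | (k \in I) && (edist (c j) (c k) <= 2 * q)] else j.
have ctr_good j : j \in good -> ctr j \in I /\ edist (c j) (c (ctr j)) <= 2 * q.
  move=> jg; rewrite /ctr jg; case: pickP => [k /andP[]//|no].
  by have [k] := near j jg; rewrite no.
have ctr_bad j : j \notin good -> ctr j = j by rewrite /ctr => /negbTE ->.
have ctr_in j : (ctr j \in good) = (j \in good).
  have [jg|jb] := boolP (j \in good).
    by have [/(fintype.subsetP Igood) -> _] := ctr_good j jg.
  by rewrite ctr_bad // (negbTE jb).
pose D' k := \big[setU/set0]_(j | ctr j == k) D j.
have D'P k x : D' k x <-> exists2 j, ctr j = k & D j x.
  rewrite /D' -bigcup_seq_cond; split=> [[j /= /andP[_ /eqP jk] Dx]|[j jk Dx]]; exists j => //=.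
  by rewrite mem_index_enum jk eqxx.
have mD' k : measurable (D' k) by exact: bigsetU_measurable_seq.
have D'd j k x : D' j x -> D' k x -> j = k.
  move=> /D'P[j' <- Dj'] /D'P[k' <- Dk'].
  by rewrite (Dd _ _ _ Dj' Dk').
have D'part : borel_partition mu D'.
  apply: disjoint_partition => //; case: (DP) => _ [<- _]; congr (mu _).
  apply/seteqP; split=> x [j _].
    by move=> /D'P[k _ Dx]; exists k.
  by move=> Dx; exists (ctr j) => //; apply/D'P; exists j.
exists D'; split => //.
  move=> k x y /D'P[j jk Dx] /D'P[j' j'k Dy].
  have gg : (j \in good) = (j' \in good) by rewrite -ctr_in jk -j'k ctr_in.
  have [jg|jb] := boolP (j \in good); last first.
    have jk' : j = k by rewrite -jk ctr_bad.
    have j'k' : j' = k by rewrite -j'k ctr_bad // -gg.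
    apply: (le_trans (Dr j x y Dx _)); first by rewrite jk' -j'k'.
    lra.
  have [_ h1] := ctr_good j jg; have [] := ctr_good j'; first by rewrite -gg.
  rewrite jk in h1; rewrite j'k => _ h2.
  have h3 := Dr j x (c j) Dx (goodP j jg).1.
  have j'g : j' \in good by rewrite -gg.
  have h4 := Dr j' (c j') y (goodP j' j'g).1 Dy.
  have t1 := edist_euclid_triangle (c j) x y.
  have t2 := edist_euclid_triangle (c k) (c j) y.
  have t3 := edist_euclid_triangle (c j') (c k) y.
  rewrite (edistC (c j') (c k)) in h2; lra.
(* The balls of radius [q] about [2 * q]-separated centres are disjoint, and each has mass at least
   [a]. *)
have aI : #|I|%:R * a <= 1.
  apply: (@le_trans _ _ (\sum_(k <- enum I) pr (eball (c k) q))).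
    rewrite big_enum /= mulr_natl -sumr_const; apply: ler_sum => k kI.
    by have [] := goodP k (fintype.subsetP Igood k kI).
  apply: sum_pr_disjoint_le1; [exact: enum_uniq|by move=> k; exact: measurable_eball|].
  move=> u v x; rewrite !mem_enum => uI vI; rewrite /eball /= => ux vx.
  apply/eqP/negPn/negP => uv.
  move/forall_inP: (Isep u uI) => /(_ v vI) /implyP /(_ uv).
  have := edist_euclid_triangle x (c u) (c v); rewrite (edistC x); lra.
have I0 : 0 < #|I|%:R :> R.
  by rewrite ltr0n; apply/card_gt0P; exists (ctr j0); have [] := ctr_good j0 j0good.
have I1 : 1 <= #|I|%:R :> R by rewrite -[1]/(1%:R) ler_nat -(ltr0n R).
have lnI : ln #|I|%:R <= - ln a.
  have : ln (#|I|%:R * a) <= 0 by exact: ln_le0.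
  rewrite lnM ?posrE //; lra.
have tot := pr_partition1 D'part.
rewrite /partition_entropy (bigID (mem I)) /=.
have tI : 0 <= \sum_(k in I) pr (D' k) <= 1.
  rewrite sumr_ge0 => [|k _]; last exact: pr_ge0.
  rewrite -tot [leRHS](bigID (mem I)) /= lerDl sumr_ge0 // => k _; exact: pr_ge0.
have part1 : \sum_(k in I) phi (pr (D' k)) <= - ln a + 1.
  apply: (le_trans (sum_phi_le_card _ (fun k => pr_ge0 mu (D' k)))).
  have [t0 t1] := andP tI.
  apply: lerD; last exact: phi_le1.
  by apply: le_trans lnI; rewrite ler_piMl // ln_ge0.
have D'bad k : k \notin good -> D' k = D k.
  move=> kb; apply/seteqP; split=> x; last first.
    by move=> Dx; apply/D'P; exists k => //; exact: ctr_bad.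
  move=> /D'P[j jk Dx]; suff <- : j = k by [].
  by rewrite -jk ctr_bad // -ctr_in jk.
(* An index outside [I] carries either an unchanged bad cell or a good one emptied by the merging,
   so only the bad cells, at most [m] of them, contribute. *)
have part2 : \sum_(k | k \notin I) phi (pr (D' k)) <=
    (\sum_(j in (~: good)%SET) pr (D j)) * ln m%:R + 1.
  rewrite (bigID (mem (~: good)%SET)) /= [X in _ + X]big1 ?addr0; last first.
    move=> k /andP[kI]; rewrite inE negbK => kg.
    rewrite (_ : D' k = set0) ?pr_set0 ?phi0 //.
    apply/seteqP; split=> // x /D'P[j jk Dx].
    have jg : j \in good by rewrite -ctr_in jk.
    by have [] := ctr_good j jg; rewrite jk (negbTE kI).
  have -> : \sum_(i < m | (i \notin I) && (i \in (~: good)%SET)) phi (pr (D' i)) =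
      \sum_(i in (~: good)%SET) phi (pr (D i)).
    apply: eq_big => [k|k /andP[_]]; last by rewrite inE => /D'bad ->.
    rewrite inE andb_idl // => kb; apply: contra kb; exact: (fintype.subsetP Igood).
  apply: (le_trans (sum_phi_le_card _ (fun k => pr_ge0 mu (D k)))).
  have b0 : 0 <= \sum_(i in (~: good)%SET) pr (D i) by apply: sumr_ge0 => k _; exact: pr_ge0.
  apply: lerD; last exact: phi_le1.
  apply: ler_wpM2l => //.
  have m1 : 1 <= m%:R :> R by rewrite -[1]/(1%:R) ler_nat (leq_trans _ (ltn_ord j0)).
  have [->|cb] := posnP #|(~: good)%SET|; first by rewrite ln0 // ln_ge0.
  rewrite ler_ln ?posrE ?ltr0n //; last by rewrite -(ltr0n R); lra.
  by rewrite ler_nat -[leqRHS](card_ord m) max_card.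
lra.
Qed.

End merging.

(** * The dimension formula *)

Section local_dimension.
Context {R : realType} {d : nat}.
Variable mu : probability (Rd R d) R.
Local Notation pr := (pr mu).

(** For [r < 1], the points whose mass exponent at scale [r] is within [e] of [s], with the division
    by [ln r] cleared. *)
Definition dim_typical (s e r : R) : set (Rd R d) :=
  [set x | (s - e) * - ln r <= - ln (pr (eball x r)) <= (s + e) * - ln r].

Lemma measurable_dim_typical s e r : measurable (dim_typical s e r).
Proof.
have mln : measurable_fun setT (fun x : Rd R d => ln (pr (eball x r))).
  apply: (measurableT_comp (@measurable_realfun.measurable_ln R)).
  exact: measurable_pr_eball.
have -> : dim_typical s e r = setT `&` (fun x : Rd R d => ln (pr (eball x r))) @^-1`
    `[- ((s + e) * - ln r), - ((s - e) * - ln r)]%classic.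
  rewrite setTI; apply/seteqP; split=> x; rewrite /dim_typical /= in_itv /= => /andP[h1 h2];
    apply/andP; split; lra.
by apply: mln => //; exact: measurable_itv.
Qed.

Lemma dim_typical_eventually s e t (K z : R) : exact_dim mu s -> 0 < e -> 0 < t ->
  0 < K -> 0 < z < 1 ->
  exists N : nat, forall n, (N <= n)%N -> 1 - t < pr (dim_typical s e (K * z ^+ n)).
Proof.
move=> hs e0 t0 K0 /andP[z0 z1].
apply: pr_eventually => //; first by move=> n; exact: measurable_dim_typical.
apply: filterS hs => x /cvgrPdist_lt /(_ e e0) [δ /= δ0 hδ].
have z01 : 0 <= z < 1 by rewrite ltW.
have m0 : 0 < Num.min δ 1 by rewrite lt_min δ0 ltr01.
have [N hN] := expr_eventually_lt z01 (ltW K0) m0.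
exists N => n /hN; rewrite lt_min; set r := K * z ^+ n => /andP[rδ r1].
have r0 : 0 < r by rewrite mulr_gt0 // exprn_gt0.
have := hδ r; rewrite /= sub0r normrN gtr0_norm // => /(_ rδ r0).
have ln0' : ln r < 0 by rewrite ln_lt0 // r0.
rewrite -/(pr (eball x r)); set P := ln (pr (eball x r)).
have PE : P = P / ln r * ln r by rewrite mulfVK // lt_eqF.
rewrite ltr_norml => /andP[h1 h2]; rewrite /dim_typical /= -/P {}PE -mulrN.
have lp : 0 < - ln r by rewrite oppr_gt0.
by rewrite !ler_pM2r //; apply/andP; split; lra.
Qed.

(** When [D' k] meets [D j] it lies in the [r]-neighbourhood of [D j], its diameter being below [r].
    The resulting bound is uniform in [D]. *)
Lemma thick_entropy_le (m m' : nat) (D : 'I_m -> set (Rd R d))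
    (D' : 'I_m' -> set (Rd R d)) (r r' : R) :
  borel_partition mu D -> borel_partition mu D' -> cells_within D' r' -> r' < r ->
  thick_entropy mu r D <= partition_entropy mu D'.
Proof.
move=> DP DP' Dr rr.
have mD j := partition_measurable j DP; have mD' k := partition_measurable k DP'.
rewrite /thick_entropy /partition_entropy.
apply: (@le_trans _ _ (\sum_(j < m) \sum_(k < m') pr (D j `&` D' k) * - ln (pr (D' k)))).
  apply: ler_sum => j _; rewrite {1}(pr_partition DP') // big_distrl /=.
  apply: ler_sum => k _.
  have [->|n0] := eqVneq (pr (D j `&` D' k)) 0; first by rewrite !mul0r.
  have jk0 : 0 < pr (D j `&` D' k) by rewrite lt_neqAle eq_sym n0 pr_ge0.
  have : (D j `&` D' k) !=set0.
    by apply/set0P/negP => /eqP h; move: n0; rewrite h pr_set0 eqxx.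
  move=> [x [Dx D'x]]; rewrite ler_pM2l // lerN2.
  have k0 : 0 < pr (D' k).
    by apply: (lt_le_trans jk0); apply: pr_le => //; exact: measurableI.
  have kt : pr (D' k) <= pr (thicken (D j) r).
    apply: pr_le => //; first exact: measurable_thicken.
    by move=> y D'y; exists x => //; apply: le_lt_trans rr; exact: Dr D'x D'y.
  by rewrite ler_ln ?posrE // (lt_le_trans k0).
rewrite exchange_big /=; apply: ler_sum => k _.
rewrite -big_distrl /=.
under eq_bigr do rewrite setIC.
by rewrite -(pr_partition DP) // phiE mulrN.
Qed.

(** If [x] lies in both [G] and [D j], the [r]-neighbourhood of [D j] is contained in the ball of
    radius [2 * r] about [x]. *)
Lemma thick_entropy_ge (m : nat) (D : 'I_m -> set (Rd R d)) (G : set (Rd R d)) (r b : R) :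
  borel_partition mu D -> cells_within D r -> 0 < r -> measurable G ->
  (forall x, G x -> b <= - ln (pr (eball x (2 * r)))) -> 0 <= b ->
  pr G * b <= thick_entropy mu r D.
Proof.
move=> DP Dr r0 mG Gb b0; have mD j := partition_measurable j DP.
rewrite (pr_partition DP) // big_distrl /=; apply: ler_sum => j _.
have tle1 : 0 <= - ln (pr (thicken (D j) r)).
  by rewrite oppr_ge0 ln_le0 // pr_le1 //; exact: measurable_thicken.
have [->|n0] := eqVneq (pr (G `&` D j)) 0.
  by rewrite mul0r mulr_ge0 // pr_ge0.
have gj0 : 0 < pr (G `&` D j) by rewrite lt_neqAle eq_sym n0 pr_ge0.
have [x [Gx Dx]] : (G `&` D j) !=set0.
  by apply/set0P/negP => /eqP h; move: n0; rewrite h pr_set0 eqxx.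
have gD : pr (G `&` D j) <= pr (D j) by apply: pr_le => //; exact: measurableI.
have t0 : 0 < pr (thicken (D j) r).
  apply: (lt_le_trans gj0); apply: (le_trans gD); apply: pr_le => //.
    exact: measurable_thicken.
  exact: sub_thicken.
apply: ler_pM => //; first exact: pr_ge0.
apply: (le_trans (Gb x Gx)); rewrite lerN2.
have te : pr (thicken (D j) r) <= pr (eball x (2 * r)).
  apply: pr_le; [exact: measurable_thicken|exact: measurable_eball|].
  move=> y [z Dz zy]; have := Dr j x z Dx Dz; rewrite /eball /=.
  have := edist_euclid_triangle z x y; lra.
by rewrite ler_ln ?posrE // (lt_le_trans t0).
Qed.

(** Cells meeting [G] have a point whose ball of radius [2 * r] has mass at least [expR (- b)], so
    [merge_cells] applies with [q = 2 * r]; this gives the diameter [4 * q + 2 * r = 10 * r]. *)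
Lemma low_entropy_partition (m : nat) (D : 'I_m -> set (Rd R d)) (G : set (Rd R d))
    (r b : R) :
  borel_partition mu D -> (forall j k x, D j x -> D k x -> j = k) ->
  cells_within D r -> 0 <= r -> measurable G -> 0 < pr G ->
  (forall x, G x -> - ln (pr (eball x (2 * r))) <= b) ->
  exists D' : 'I_m -> set (Rd R d), [/\ borel_partition mu D',
    cells_within D' (10 * r) &
    partition_entropy mu D' <= b + (1 - pr G) * ln m%:R + 2].
Proof.
move=> DP Dd Dr r0 mG G0 Gb; have mD j := partition_measurable j DP.
(* Because [ln 0 = 0], the bound on [G] controls the mass of a ball only if that mass is positive;
   [0 < pr (D j)] guarantees this. *)
pose good := [set j : 'I_m | (0 < pr (D j)) && `[< (D j `&` G) !=set0 >] ]%SET.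
pose c j : Rd R d := xget (0 : 'rV[R]_d) (D j `&` G).
have cP j : j \in good -> (D j `&` G) (c j).
  rewrite inE => /andP[_ /asboolP [x Ax]]; exact: (xgetPex _ (ex_intro _ x Ax)).
have notgood j : j \notin good -> pr (G `&` D j) = 0.
  rewrite inE negb_and -leNgt => /orP[h|/asboolPn h].
    apply/eqP; rewrite eq_le pr_ge0 andbT; apply: le_trans h.
    by apply: pr_le => //; exact: measurableI.
  rewrite setIC (_ : _ `&` _ = set0) ?pr_set0 //.
  by apply/eqP/negPn/negP => /set0P.
have Gle : pr G <= \sum_(j in good) pr (D j).
  rewrite (pr_partition DP) // (bigID (mem good)) /= [X in _ + X]big1 ?addr0.
    by apply: ler_sum => j _; apply: pr_le => //; exact: measurableI.
  by move=> j; exact: notgood.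
have good0 : good != finset.set0.
  apply/negP => /eqP g0; move: Gle; rewrite g0 big_set0; lra.
have a0 := expR_gt0 (- b).
have goodP j : j \in good -> D j (c j) /\ expR (- b) <= pr (eball (c j) (2 * r)).
  move=> jg; have [Dc Gc] := cP j jg; split=> //.
  have Dj0 : 0 < pr (D j) by move: jg; rewrite inE => /andP[].
  have e0 : 0 < pr (eball (c j) (2 * r)).
    apply: (lt_le_trans Dj0); apply: pr_le => //; first exact: measurable_eball.
    move=> x Dx; have := Dr j (c j) x Dc Dx; rewrite /eball /=; lra.
  rewrite -[leRHS]lnK ?posrE // ler_expR.
  have := Gb _ Gc; lra.
have r20 : 0 <= 2 * r by lra.
have [D' [DP' Dr' H']] := merge_cells DP Dd Dr r0 r20 a0 good0 goodP.
exists D'; split => //.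
  move=> j x y Dx Dy; have := Dr' j x y Dx Dy; lra.
apply: (le_trans H'); rewrite expRK opprK lerD2r lerD2l.
have [j _] := set0Pn _ good0.
apply: ler_wpM2r; first by rewrite ln_ge0 // -[1]/(1%:R) ler_nat (leq_trans _ (ltn_ord j)).
have := pr_partition1 DP; rewrite (bigID (mem good)) /=.
under [in X in _ -> X]eq_bigl do rewrite inE.
lra.
Qed.

End local_dimension.

Section dimension_formula.
Context {R : realType} {d l : nat}.
Variables (S : 'I_l -> Rd R d -> Rd R d) (rho p : 'I_l -> R).
Variables (mu : probability (Rd R d) R) (s : R).
Hypothesis S_sim : forall i, similarity_ratio (S i) (rho i).
Hypothesis p0 : forall i, 0 < p i.
Hypothesis p1 : \sum_(i < l) p i = 1.
Hypothesis mu_ss : self_similar S p mu.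
Hypothesis mu_dim : exact_dim mu s.
Local Notation pr := (pr mu).

(** Partitions of all sizes are packed into one type, as [renewal_bound] requires. *)
Definition pull_partition (i : 'I_l) (E : {m : nat & 'I_m -> set (Rd R d)}) :
  {m : nat & 'I_m -> set (Rd R d)} :=
  existT _ (projT1 E) (fun j => S i @^-1` projT2 E j).

Lemma cells_within_preimage (m : nat) (D : 'I_m -> set (Rd R d)) r i :
  cells_within D r -> cells_within (fun j => S i @^-1` D j) (r / rho i).
Proof.
move=> Dr j x y Dx Dy; have [r0 _] := andP (ratio01 S_sim i).
by rewrite ler_pdivlMr // mulrC -(edist_similarity S_sim); exact: Dr Dx Dy.
Qed.

Lemma ln_scale (K z : R) n : 0 < K -> 0 < z ->
  - ln (K * z ^+ n) = n%:R * - ln z - ln K.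
Proof.
move=> K0 z0; rewrite lnM ?posrE ?exprn_gt0 // lnXn // -[_ *+ n]mulr_natl; ring.
Qed.

Lemma nat_linear_bounded (x C : R) (N : nat) :
  (forall n, (N <= n)%N -> n%:R * x <= C) -> x <= 0.
Proof.
move=> h; rewrite leNgt; apply/negP => x0.
pose n := maxn N (Num.truncn (C / x)).+1.
have := h n (leq_maxl _ _); apply/negP; rewrite -ltNge -ltr_pdivrMr //.
apply: (lt_le_trans (truncnS_gt _)); rewrite ler_nat; exact: leq_maxr.
Qed.

(** For fine partitions at scale [r], [thick_entropy] grows at most like [b * - ln r] by renewal and
    at least almost like [s * - ln r] by exact dimensionality; [s > b] is then impossible as [r]
    tends to 0. *)
Lemma dim_le (h : R) : h <= entropy p ->
  (forall (m : nat) (D : 'I_m -> set (Rd R d)), borel_partition mu D ->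
     h <= part_sum S p mu D) ->
  s <= (entropy p - h) / lyap p rho.
Proof.
move=> hp hP; rewrite leNgt; apply/negP; set b := _ / _ => bs.
have lp := lyap_gt0 p0 p1 (ratio01 S_sim).
have b0 : 0 <= b by rewrite divr_ge0 // ?subr_ge0 // ltW.
have [rmin [rmax [rmin0 rmax01 rminP rmaxP]]] := ratio_bounds (ratio01 S_sim).
have [z0 z1] := andP rmax01.
have [K K0 hfine] := fine_partition S_sim p0 p1 mu_ss rmax01 rmaxP.
have z01 : 0 <= rmax < 1 by rewrite ltW.
(* A fixed partition finer than [rmin] bounds [thick_entropy] of every partition at all scales from
   [rmin] up; this is the base case of the renewal. *)
have [n0 hn0] := expr_eventually_lt z01 (ltW K0) rmin0.
have [D0 [DP0 _ Dr0]] := hfine n0.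
pose C := partition_entropy mu D0.
pose Q (r : R) (E : {m : nat & 'I_m -> set (Rd R d)}) := borel_partition mu (projT2 E).
pose F r (E : {m : nat & 'I_m -> set (Rd R d)}) := thick_entropy mu r (projT2 E).
have unit01 : 0 < (1 : R) <= 1 by rewrite ltr01 lexx.
have Qpull r E i : Q r E -> Q (r / rho i) (pull_partition i E).
  by move=> QE; exact: (partition_preimage S_sim p0 mu_ss i QE).
have Frec r E : 0 < r <= 1 -> Q r E ->
    F r E <= (entropy p - h) + \sum_(i < l) p i * F (r / rho i) (pull_partition i E).
  move=> /andP[r0 _] QE.
  rewrite /F; apply: (le_trans (thick_entropy_rec S_sim p0 mu_ss r0 QE)).
  by rewrite lerD2r lerD2l lerN2; exact: hP.
have Fbase r E : rmin * 1 <= r <= 1 -> Q r E -> F r E <= C.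
  move=> /andP[rr _] QE; apply: (thick_entropy_le QE DP0 Dr0).
  by apply: (lt_le_trans (hn0 _ (leqnn _))); rewrite -[rmin]mulr1.
have bound := renewal_bound p0 p1 (ratio01 S_sim) rminP rmaxP rmin0 rmax01
  unit01 Qpull Frec Fbase.
rewrite -/b in bound; move: bound; set C' := C + _ => bound.
clearbody b C'.
(* One [e] is lost to the local dimension, one to atypical points, and one is left for the
   contradiction. *)
have [e e0 h4] : exists2 e, 0 < e & s = b + 3 * e by exists ((s - b) / 3); lra.
(* Chosen so that atypical mass [t] lowers the slope by [t * (s - e) <= e]. *)
pose t := e / (s + 1); have s1 : 0 < s + 1 by lra.
have t0 : 0 < t by exact: divr_gt0.
have ts : t * (s + 1) = e by rewrite /t mulfVK // gt_eqF.
have K2 : 0 < 2 * K by lra.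
have [N1 hN1] := dim_typical_eventually mu_dim e0 t0 K2 rmax01.
have [N2 hN2] := expr_eventually_lt z01 (ltW K2) (@ltr01 R).
have lz : 0 < - ln rmax by rewrite oppr_gt0 ln_lt0.
suff : e * - ln rmax <= 0 by rewrite leNgt mulr_gt0.
apply: (@nat_linear_bounded _ (b * ln 2 + C' + e * ln (2 * K)) (maxn N1 N2)) => n.
rewrite geq_max => /andP[/hN1 G1 /hN2 r1].
have [D [DP _ Dr]] := hfine n.
have r0 : 0 < K * rmax ^+ n by rewrite mulr_gt0 // exprn_gt0.
have LE := ln_scale n K2 z0.
have LE' := ln_scale n K0 z0.
have ln2K : ln (2 * K) = ln 2 + ln K by rewrite lnM ?posrE.
have L0 : 0 <= - ln (2 * K * rmax ^+ n) by rewrite oppr_ge0 ln_le0 // ltW.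
have se0 : 0 <= s - e by lra.
have := @thick_entropy_ge _ _ mu _ D _ _ ((s - e) * - ln (2 * K * rmax ^+ n)) DP Dr r0
  (measurable_dim_typical mu s e (2 * K * rmax ^+ n)).
rewrite -!mulrA => /(_ _)/wrap[x /andP[] //|].
rewrite !mulrA mulr_ge0 // => /(_ isT) lo.
have := bound (K * rmax ^+ n) (existT _ _ D); rewrite /Q /F /= => /(_ _ DP)/wrap[|hi].
  by rewrite r0 /=; lra.
have {lo hi} := le_trans lo hi.
move: G1 L0; rewrite LE LE' ln2K; set L := _ - (_ + _) => G1 L0 hh.
have h1 : (1 - t) * ((s - e) * L) <= pr (dim_typical mu s e (2 * K * rmax ^+ n)) * ((s - e) * L).
  by apply: ler_wpM2r; [exact: mulr_ge0|exact: ltW].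
have h2 : t * (s - e) <= e by rewrite -ts; apply: ler_wpM2l; [exact: ltW|lra].
have h3 : t * (s - e) * L <= e * L by exact: ler_wpM2r.
have h5 : n%:R * - ln rmax = L + ln 2 + ln K by rewrite /L; ring.
have h6 : e * (n%:R * - ln rmax) = e * (L + ln 2 + ln K) by rewrite h5.
have h7 : b * (n%:R * - ln rmax) = b * (L + ln 2 + ln K) by rewrite h5.
have h8 : (s - 2 * e) * L = (b + e) * L by rewrite h4; congr (_ * _); ring.
lra.
Qed.

(** By [part_sum_fine] the chain rule becomes a renewal inequality, so all partitions of diameter at
    most [r] have entropy at least [b * - ln r] up to a constant. If [s < b], the partitions from
    [low_entropy_partition] violate this at small scales. *)
Lemma dim_ge (m0 : nat) (D0 : 'I_m0 -> set (Rd R d)) : borel_partition mu D0 ->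
  (entropy p - part_sum S p mu D0) / lyap p rho <= s.
Proof.
move=> DP0.
have lp := lyap_gt0 p0 p1 (ratio01 S_sim).
apply/ler_addgt0Pl => e' e'0; rewrite -lerBlDl.
have le0 : 0 < e' * lyap p rho by exact: mulr_gt0.
have [δ δ0 hδ] := part_sum_fine S_sim p0 mu_ss DP0 le0.
set b := _ - _; rewrite leNgt; apply/negP => bs.
pose c := b * lyap p rho.
have cE : c = entropy p - part_sum S p mu D0 - e' * lyap p rho.
  by rewrite /c /b mulrBl mulfVK // gt_eqF.
have [rmin [rmax [rmin0 rmax01 rminP rmaxP]]] := ratio_bounds (ratio01 S_sim).
have [z0 z1] := andP rmax01.
have z01 : 0 <= rmax < 1 by rewrite ltW.
have [K K0 hfine] := fine_partition S_sim p0 p1 mu_ss rmax01 rmaxP.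
pose Q (r : R) (E : {m : nat & 'I_m -> set (Rd R d)}) :=
  borel_partition mu (projT2 E) /\ cells_within (projT2 E) r.
(* The sign turns a lower bound on entropy into the upper bound of [renewal_bound]; the base case is
   nonnegativity of entropy. *)
pose F (r : R) (E : {m : nat & 'I_m -> set (Rd R d)}) := - partition_entropy mu (projT2 E).
pose r0 := Num.min δ 1.
have r01 : 0 < r0 <= 1 by rewrite lt_min δ0 ltr01 /= ge_min lexx orbT.
have Qpull r E i : Q r E -> Q (r / rho i) (pull_partition i E).
  move=> [QE Er]; split; first exact: (partition_preimage S_sim p0 mu_ss i QE).
  exact: cells_within_preimage Er.
have Frec r E : 0 < r <= r0 -> Q r E ->
    F r E <= - c + \sum_(i < l) p i * F (r / rho i) (pull_partition i E).
  move=> /andP[_ rr0] [QE Er]; rewrite /F /= (partition_entropy_rec S_sim p0 mu_ss QE).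
  have Eδ : cells_within (projT2 E) δ.
    move=> j x y Dx Dy; apply: (le_trans (Er _ _ _ Dx Dy)); apply: (le_trans rr0).
    by rewrite ge_min lexx.
  have := hδ _ _ QE Eδ.
  under [in X in _ -> X]eq_bigr do rewrite mulrN.
  rewrite sumrN cE; lra.
have Fbase r E : rmin * r0 <= r <= r0 -> Q r E -> F r E <= 0.
  by move=> _ [QE _]; rewrite oppr_le0; exact: partition_entropy_ge0.
have bound := renewal_bound p0 p1 (ratio01 S_sim) rminP rmaxP rmin0 rmax01
  r01 Qpull Frec Fbase.
have bE : - c / lyap p rho = - b by rewrite mulNr /c mulfK // gt_eqF.
rewrite bE in bound; move: bound; set C' := 0 + _ => bound.
have [e e0 h4] : exists2 e, 0 < e & b = s + 3 * e by exists ((b - s) / 3); lra.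
have lz : 0 < - ln rmax by rewrite oppr_gt0 ln_lt0.
have l0 : (0 < l)%N.
  rewrite lt0n; apply/negP => /eqP lE; move: p1; rewrite big1.
    by move/eqP; rewrite eq_sym oner_eq0.
  by move=> i _; have := ltn_ord i; rewrite {2}lE ltn0.
have lnl : 0 <= ln l%:R :> R by rewrite ln_ge0 // -[1]/(1%:R) ler_nat.
have lnl1 : 0 < ln l%:R + 1 :> R by lra.
(* [2^-1] keeps the typical set of positive mass; the other bound makes the atypical mass times
   [ln (l ^ n)] at most [n * e * - ln rmax]. *)
pose t := Num.min 2^-1 (e * - ln rmax / (ln l%:R + 1)).
have t0 : 0 < t by rewrite lt_min invr_gt0 ltr0n /= divr_gt0 // mulr_gt0.
have th : t <= 2^-1 by rewrite ge_min lexx.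
have tl : t * ln l%:R <= e * - ln rmax.
  apply: (@le_trans _ _ (t * (ln l%:R + 1))); first by apply: ler_wpM2l; [exact: ltW|lra].
  by rewrite -ler_pdivlMr // ge_min lexx orbT.
have K2 : 0 < 2 * K by lra.
have K10 : 0 < 10 * K by lra.
have r00 : 0 < r0 by case/andP: r01.
have [N1 hN1] := dim_typical_eventually mu_dim e0 t0 K2 rmax01.
have [N2 hN2] := expr_eventually_lt z01 (ltW K10) r00.
suff : e * - ln rmax <= 0 by rewrite leNgt mulr_gt0.
apply: (@nat_linear_bounded _ (b * ln (10 * K) + C' - (s + e) * ln (2 * K) + 2) (maxn N1 N2)) => n.
rewrite geq_max => /andP[/hN1 G1 /hN2 r1].
have [D [DP Dd Dr]] := hfine n.
have rp : 0 < K * rmax ^+ n by rewrite mulr_gt0 // exprn_gt0.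
have LE := ln_scale n K2 z0.
have LE' := ln_scale n K10 z0.
have G0 : 0 < pr (dim_typical mu s e (2 * K * rmax ^+ n)) by lra.
have := @low_entropy_partition _ _ mu _ D _ _ ((s + e) * - ln (2 * K * rmax ^+ n)) DP Dd Dr (ltW rp)
  (measurable_dim_typical mu s e (2 * K * rmax ^+ n)) G0.
rewrite [2 * (K * _)]mulrA => /(_ _)/wrap[x /andP[] //|[D' [DP' Dr' H']]].
have := bound (10 * K * rmax ^+ n) (existT _ _ D'); rewrite /Q /F /= => /(_ _ _)/wrap[||lo].
- by rewrite mulr_gt0 ?exprn_gt0 // ltW.
- by split=> //; rewrite -mulrA.
have lnm : ln (l ^ n)%:R = n%:R * ln l%:R :> R.
  by rewrite natrX lnXn ?ltr0n // mulr_natl.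
rewrite lnm in H'.
have h1 : (1 - pr (dim_typical mu s e (2 * K * rmax ^+ n))) * (n%:R * ln l%:R) <=
    t * (n%:R * ln l%:R).
  by apply: ler_wpM2r; [rewrite mulr_ge0|lra].
have h2 : t * (n%:R * ln l%:R) <= n%:R * (e * - ln rmax).
  by rewrite mulrCA; apply: ler_wpM2l.
rewrite LE in H'; rewrite LE' in lo.
move: lo; rewrite mulNr h4 => lo.
have := lerD lo H'.
lra.
Qed.

End dimension_formula.

Lemma max_diam_cells_within {R : realType} {d m : nat} (D : 'I_m -> set (Rd R d)) (r : R) :
  (max_diam D <= r%:E)%E -> cells_within D r.
Proof.
move=> h j x y Dx Dy; rewrite -lee_fin; apply: le_trans h.
apply: (@le_trans _ _ (ediam (D j))); last exact: le_bigmax_cond.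
by apply: ereal_sup_ubound; left; exists x => //; exists y.
Qed.

(** Superadditivity merges all cells into the vector [p], whose [fent] is its entropy since its
    total is 1. *)
Lemma part_sum_le_entropy {R : realType} {d l m : nat} (S : 'I_l -> Rd R d -> Rd R d)
    (rho p : 'I_l -> R) (mu : probability (Rd R d) R) (D : 'I_m -> set (Rd R d)) :
  (forall i, similarity_ratio (S i) (rho i)) ->
  (forall i, 0 < p i) -> \sum_(i < l) p i = 1 -> self_similar S p mu ->
  borel_partition mu D -> part_sum S p mu D <= entropy p.
Proof.
move=> S_sim p0 p1 mu_ss DP; rewrite part_sumE.
apply: (le_trans (fent_superadditive _ (fun j => cell_weights_ge0 S mu p0 (D j)))).
rewrite (_ : (fun i => _) = p); last first.
  by apply/funext => i; exact: (sum_cell_weights S_sim p0 mu_ss i DP).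
rewrite fentE; last by move=> i; exact: ltW.
rewrite p1 phiE ln1 mulr0 oppr0 subr0 /entropy.
by apply: ler_sum => i _; rewrite phiE.
Qed.

Unset Implicit Arguments.

Theorem theorem1p1 (R : realType) (d l : nat)
  (S : 'I_l -> Rd R d -> Rd R d) (rho p : 'I_l -> R)
  (mu : probability (Rd R d) R) (s : R) :
  (forall i, similarity_ratio (S i) (rho i)) ->
  (forall i, 0 < p i) -> \sum_(i < l) p i = 1 ->
  self_similar S p mu ->
  exact_dim mu s ->
  (* (i) *)
  (forall (m : nat) (D : 'I_m -> set (Rd R d)),
     borel_partition mu D ->
     s >= (entropy p - part_sum S p mu D) / lyap p rho /\
     (forall y : 'I_m -> 'I_l -> R,
        (forall j i, 0 <= y j i) ->
        (forall j i, p i * fine (mu (S i @^-1` D j)) <= y j i) ->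
        s >= (entropy p - \sum_(j < m) fent (y j)) / lyap p rho)) /\
  (* (ii) *)
  (forall (m : nat -> nat) (D : forall n, 'I_(m n) -> set (Rd R d)),
     (forall n, borel_partition mu (D n)) ->
     (fun n => max_diam (D n)) @ \oo --> 0%E ->
     exists L : R,
       (fun n => part_sum S p mu (D n)) @ \oo --> L /\
       s = (entropy p - L) / lyap p rho).
Proof.
move=> S_sim p0 p1 mu_ss mu_dim.
have lp := lyap_gt0 p0 p1 (ratio01 S_sim).
have lower m (D : 'I_m -> set (Rd R d)) := @dim_ge _ _ _ S rho p mu s S_sim p0 p1 mu_ss mu_dim m D.
split=> [m D DP|m D DP Ddiam].
  split=> [|y y0 hy]; first exact: lower.
  apply: le_trans (lower m D DP); rewrite ler_pM2r ?invr_gt0 // lerD2l lerN2.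
  by apply: ler_sum => j _; apply: fent_le => i //; exact: cell_weights_ge0.
(* The limit will be the infimum of the sums over all partitions: a near-minimal partition controls
   every sufficiently fine one through [part_sum_fine]. *)
pose P : set R := [set x | exists m (E : 'I_m -> set (Rd R d)),
  borel_partition mu E /\ x = part_sum S p mu E].
have Plb : lbound P 0.
  move=> _ [m' [E [_ ->]]]; apply: sumr_ge0 => j _; apply: fent_ge0 => i.
  exact: cell_weights_ge0.
have Pinf : has_inf P.
  by split; [exists (part_sum S p mu (D 0%N)), (m 0%N), (D 0%N)|exists 0].
have infP m' (E : 'I_m' -> set (Rd R d)) : borel_partition mu E -> inf P <= part_sum S p mu E.
  by move=> EP; apply: ge_inf; [exists 0|exists m', E].
exists (inf P); split.
  apply/cvgrPdist_lt => e e0; have e20 : 0 < e / 2 by lra.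
  have [_ [m0 [E [EP ->]]] PE] := inf_adherent e20 Pinf.
  have e40 : 0 < e / 4 by lra.
  have [r r0 hr] := part_sum_fine S_sim p0 mu_ss EP e40.
  have : nbhs (0%E : \bar R) [set x | (x < r%:E)%E].
    by apply: open_nbhs_nbhs; split; [exact: open_ereal_lt_ereal|rewrite /= lte_fin].
  move=> /Ddiam [N _ hN]; exists N => // n /hN /= /ltW /max_diam_cells_within Dr.
  have h1 := hr _ _ (DP n) Dr; have h2 := infP _ _ (DP n).
  rewrite ler0_norm; lra.
apply/eqP; rewrite eq_le; apply/andP; split.
  apply: (dim_le S_sim p0 p1 mu_ss mu_dim) => //.
  apply: (le_trans (infP _ _ (DP 0%N))).
  exact: part_sum_le_entropy S_sim p0 p1 mu_ss (DP 0%N).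
(* Conversely, [dim_ge] holds for every partition, so it survives passing to the infimum. *)
rewrite ler_pdivrMr //.
suff : entropy p - s * lyap p rho <= inf P by lra.
apply: lb_le_inf; first by case: Pinf.
move=> _ [m' [E [EP ->]]]; have := lower _ _ EP; rewrite ler_pdivrMr //; lra.
Qed.
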